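(* For every $n\ge 1$ and every pair of partitions $\lambda,\mu$, the function $\mathbb{F}_{\lambda/\mu}(\kappa_1,\dots,\kappa_n\mid\Xi,\mathsf{S})$ is a symmetric polynomial in $\kappa_1,\dots,\kappa_n$.
   Context: Fix a generic parameter $q$, and write $(x;q)_n:=\prod_{i=1}^n(1-xq^{i-1})$, $(x;q)_0:=1$. A partition is a weakly decreasing sequence $\lambda=(\lambda_1\ge\lambda_2\ge\dots\ge0)$ of nonnegative integers with finitely many nonzero entries; $l(\lambda)$ is the number of nonzero parts and $\lambda'$ is the conjugate partition, so the number of parts of $\lambda'$ equal to $j$ is $m_j(\lambda')=\lambda_j-\lambda_{j+1}$. Let $\Xi=(\xi_0,\xi_1,\dots)$ and $\mathsf{S}=(s_0,s_1,\dots)$ be sequences of generic parameters, with fixed square roots $\sqrt{\xi_i},\sqrt{s_i}$. For $k\ge0$ put $\xi_i^{(k)}:=\sqrt{\xi_{i+k}s_{i+k}\xi_i/s_i}$, $s_i^{(k)}:=\sqrt{s_{i+k}\xi_{i+k}s_i/\xi_i}$ (with these roots formed from the fixed ones), and $\tau^k_{\mathsf{S}}\Xi:=(\xi^{(k)}_0,\xi^{(k)}_1,\dots)$, $\tau^k_{\Xi}\mathsf{S}:=(s^{(k)}_0,s^{(k)}_1,\dots)$. Vertex weights: for $i,j,k,l\in\mathbb{Z}_{\ge0}$ (labels of the bottom, left, top, right edge), $$W_{t,s}(i,j;k,l):=\mathbf{1}_{i+j=k+l}\,\mathbf{1}_{i\ge l}\,(s^2/t^2)^{l}\frac{(s^2/t^2;q)_{i-l}(t^2;q)_l}{(s^2;q)_i}\frac{(q;q)_i}{(q;q)_{i-l}(q;q)_l},$$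 which depends only on $t^2,s^2$. Partition function: for $a_1,\dots,a_n\in\mathbb{Z}_{\ge0}$ and $L>l(\lambda),l(\mu)$, $$ZW^{(a_1,\dots,a_n)}_{\lambda/\mu}(\kappa_1,\dots,\kappa_n\mid\Xi,\mathsf{S}):=\sum\prod_{r=1}^n\prod_{c=1}^L W_{t_{r,c},\,s^{(r)}_c}(v_{r,c},h_{r,c-1};v_{r-1,c},h_{r,c}),\qquad t_{r,c}^2=\frac{\xi_{r+c}s_{r+c}}{\kappa_r},$$ where the sum is over all nonnegative integers $v_{r,c}$ ($0\le r\le n$, $1\le c\le L$) and $h_{r,c}$ ($1\le r\le n$, $0\le c\le L$) subject to $v_{0,c}=m_c(\lambda')$, $v_{n,c}=m_c(\mu')$, $h_{r,0}=a_r$, $h_{r,L}=0$; the result does not depend on $L$. Set $$\mathbb{F}^{\mathsf s}_{\lambda/\mu}(\kappa_1,\dots,\kappa_n\mid\Xi,\mathsf{S}):=\sum_{a_1+\dots+a_n=\lambda_1-\mu_1}\Bigl(\prod_{i=1}^n(\kappa_is_0/\xi_0)^{a_i}\frac{(\kappa_i^{-1}s_i\xi_i;q)_{a_i}}{(q;q)_{a_i}}\Bigr)ZW^{(a_1,\dots,a_n)}_{\lambda/\mu}(\kappa_1,\dots,\kappa_n\mid\Xi,\mathsf{S}),$$ $$\mathbb{F}_{\lambda/\mu}(\kappa_1,\dots,\kappa_n\mid\Xi,\mathsf{S}):=\frac{(-\tau^n_\Xi\mathsf{S})^{\mu}}{(-\mathsf{S})^{\lambda}}\frac{\mathsf{c}_{\tau^n_\Xi\mathsf{S}}(\mu)}{\mathsf{c}_{\mathsf{S}}(\lambda)}\,\mathbb{F}^{\mathsf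 s}_{\lambda/\mu}(\kappa_1,\dots,\kappa_n\mid\Xi,\mathsf{S}),$$ where $\mathsf{c}_{\mathsf{S}}(\lambda):=\prod_{i\ge1}\frac{(s_i^2;q)_{\lambda_i-\lambda_{i+1}}}{(q;q)_{\lambda_i-\lambda_{i+1}}}$ and $(-\mathsf{S})^\lambda:=\prod_{i\ge1}(-s_{i-1})^{\lambda_i}$ (and likewise with $\mathsf S$ replaced by $\tau^n_\Xi\mathsf S$). *)

(* Defs.v *)
(* Mathematical Components and multinomials. *)
From HB Require Import structures.
From mathcomp Require Import all_boot all_order all_algebra.
From mathcomp Require Import mpoly.

Set Implicit Arguments.
Unset Strict Implicit.
Unset Printing Implicit Defensive.

Import Order.TTheory GRing.Theory Num.Theory.
Local Open Scope ring_scope.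

(* A partition is encoded by the list of its nonzero parts, so that
   l(la) = size la. *)
Definition is_part (la : seq nat) : bool := sorted geq la && (0%N \notin la).

(* 1-based: part la i is the i-th part, for i >= 1, and 0 past the length. *)
Definition part (la : seq nat) (i : nat) : nat := nth 0%N la i.-1.

Definition conj_part (la : seq nat) : seq nat :=
  mkseq (fun j => count (fun x => (j < x)%N) la) (part la 1).

Definition mult (la : seq nat) (j : nat) : nat := count_mem j la.

Section Functions.

Variable F : fieldType.

(* (x; q)_n *)
Definition qpoch (q x : F) (n : nat) : F := \prod_(i < n) (1 - x * q ^+ i).

(* Square roots are the primitive data: rxi i and rs i stand for the fixed
   square roots of xi_i and s_i, so xi_i = rxi i ^+ 2 and s_i = rs i ^+ 2. *)
Section Weights.

Variables (q : F) (rxi rs : nat -> F).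

Definition xi (i : nat) : F := rxi i ^+ 2.
Definition spar (i : nat) : F := rs i ^+ 2.

(* The i-th entry s_i^(k) of tau^k_Xi S. *)
Definition spar_shift (k i : nat) : F := rs (i + k) * rxi (i + k) * rs i / rxi i.

(* The vertex weight W_{t,s}(i, j; k, l), as a function of t2 = t^2 and
   s2 = s^2. *)
Definition vertexW (t2 s2 : F) (i j k l : nat) : F :=
  if ((i + j == k + l) && (l <= i))%N then
    (s2 / t2) ^+ l
    * (qpoch q (s2 / t2) (i - l) * qpoch q t2 l / qpoch q s2 i)
    * (qpoch q q i / (qpoch q q (i - l) * qpoch q q l))
  else 0.

Section Lattice.

(* kappa r stands for kappa_{r+1}. *)
Variables (n L : nat) (kappa : 'I_n -> F).

(* Edge labels: v r c is v_{r,c+1} and h r c is h_{r+1,c}. *)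
Definition zw_boundary (la mu : seq nat) (a : 'I_n -> nat)
    (v : 'I_n.+1 -> 'I_L -> nat) (h : 'I_n -> 'I_L.+1 -> nat) : bool :=
  [&& [forall c : 'I_L, v ord0 c == mult (conj_part la) c.+1],
      [forall c : 'I_L, v ord_max c == mult (conj_part mu) c.+1],
      [forall r : 'I_n, h r ord0 == a r]
    & [forall r : 'I_n, h r ord_max == 0%N]].

(* For r : 'I_n, lift ord0 r is r + 1 and widen_ord (leqnSn n) r is r; the
   factor at (r, c) is the weight of the vertex in row r + 1, column c + 1. *)
Definition zw_weight
    (v : 'I_n.+1 -> 'I_L -> nat) (h : 'I_n -> 'I_L.+1 -> nat) : F :=
  \prod_(r < n) \prod_(c < L)
    vertexW (xi (r.+1 + c.+1) * spar (r.+1 + c.+1) / kappa r)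
            (spar_shift r.+1 c.+1 ^+ 2)
            (v (lift ord0 r) c) (h r (widen_ord (leqnSn L) c))
            (v (widen_ord (leqnSn n) r) c) (h r (lift ord0 c)).

(* Restricting the sum over all natural labels to labels at most la_1 loses no
   nonzero term: see zw_labels_bounded below. *)
Definition ZW (la mu : seq nat) (a : 'I_n -> nat) : F :=
  \sum_(v : 'M['I_(part la 1).+1]_(n.+1, L))
    \sum_(h : 'M['I_(part la 1).+1]_(n, L.+1)
            | zw_boundary la mu a (fun r c => v r c) (fun r c => h r c))
      zw_weight (fun r c => v r c) (fun r c => h r c).

(* The condition on a is written additively because part la 1 may be smaller
   than part mu 1, in which case the sum is empty. *)
Definition Fs (la mu : seq nat) : F :=
  \sum_(a : {ffun 'I_n -> 'I_(part la 1).+1}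
          | (\sum_(r < n) a r + part mu 1 == part la 1)%N)
    (\prod_(r < n)
       ((kappa r * spar 0 / xi 0) ^+ a r
        * (qpoch q ((kappa r)^-1 * spar r.+1 * xi r.+1) (a r)
           / qpoch q q (a r))))
    * ZW la mu (fun r => a r).

End Lattice.

End Weights.

(* c_S(la) and (-S)^la; all factors with i > l(la) are equal to 1. *)
Definition cfac (q : F) (s : nat -> F) (la : seq nat) : F :=
  \prod_(1 <= i < (size la).+1)
    (qpoch q (s i ^+ 2) (part la i - part la i.+1)
     / qpoch q q (part la i - part la i.+1)).

Definition negpow (s : nat -> F) (la : seq nat) : F :=
  \prod_(1 <= i < (size la).+1) (- s i.-1) ^+ part la i.

(* FF is the function F_{la/mu}(kappa_1, ..., kappa_n | Xi, S), with the
   partition function computed on L columns. *)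
Definition FF (q : F) (rxi rs : nat -> F) (n L : nat) (la mu : seq nat)
    (kappa : 'I_n -> F) : F :=
  negpow (spar_shift rxi rs n) mu / negpow (spar rs) la
  * (cfac q (spar_shift rxi rs n) mu / cfac q (spar rs) la)
  * Fs q rxi rs L kappa la mu.

(* Genericity: q is neither 0 nor a root of unity, the square roots are nonzero,
   and no (s_i^(k))^2 is of the form q^(-j), so that no denominator in the
   definitions above vanishes. In particular algebraically independent
   parameters are generic. *)
Definition generic (q : F) (rxi rs : nat -> F) : Prop :=
  [/\ q != 0,
      forall k, (0 < k)%N -> q ^+ k != 1,
      forall i, rxi i != 0,
      forall i, rs i != 0
    & forall i k j, spar_shift rxi rs k i ^+ 2 * q ^+ j != 1].

End Functions.

(* F_{la/mu} as a rational function: the value of FF at the indeterminates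
   kappa_r = 'X_r of the field of fractions of K[X_1, ..., X_n]. *)
Section RationalFunction.

Variables (K : fieldType) (n : nat).

Definition mpoly_frac (p : {mpoly K[n]}) : {fraction {mpoly K[n]}} := tofrac p.

Definition const_frac (x : K) : {fraction {mpoly K[n]}} := mpoly_frac x%:MP.

Definition FF_rat (q : K) (rxi rs : nat -> K) (L : nat) (la mu : seq nat) :
    {fraction {mpoly K[n]}} :=
  FF (const_frac q) (fun i => const_frac (rxi i)) (fun i => const_frac (rs i))
     L la mu (fun r : 'I_n => mpoly_frac 'X_r).

End RationalFunction.

Lemma part_nonincr la i :
  is_part la -> (0 < i)%N -> (part la i.+1 <= part la i)%N.
Proof.
case: i => // i /andP[la_s _] _; rewrite /part /=.
have [lt_i|le_i] := ltnP i.+1 (size la); last by rewrite nth_default.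
have := @sorted_leq_nth _ geq _ _ 0%N la la_s i i.+1.
by apply => //; [move=> x y z /= h1 h2; apply: leq_trans h1 | exact: leqnn |
  rewrite inE ltnW].
Qed.

Lemma mult_conj_part la j : is_part la -> (0 < j)%N ->
  mult (conj_part la) j = (part la j - part la j.+1)%N.
Proof.
move=> la_p j0; have la_s : sorted geq la by case/andP: la_p.
have geq_tr : transitive geq by move=> x y z /= h1 h2; apply: leq_trans h1.
have lt_count m : (count (fun x => (m < x)%N) la =
   find (fun x => ~~ (m < x)%N) la).
  elim: la la_s {la_p} => //= x la IH la_s.
  have /IH -> := path_sorted la_s.
  case: ltnP => //= le_xm; rewrite add0n.
  case: la la_s {IH} => //= y la /andP[le_yx _].
  by rewrite -leqNgt (leq_trans le_yx).
have find_gt m i : (i < find (fun x => ~~ (m < x)%N) la)%N = (m < part la i.+1)%N.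
  rewrite /part /=; apply/idP/idP => [lt_i|lt_m].
    by have /(_ 0%N)/negbFE := before_find _ lt_i.
  rewrite ltnNge; apply/negP => le_i.
  have i_la : (i < size la)%N.
    by rewrite ltnNge; apply: contraTN lt_m => /(nth_default 0%N) ->.
  have hf : has (fun x => ~~ (m < x)%N) la by rewrite has_find (leq_ltn_trans le_i).
  have /negP := nth_find 0%N hf; apply; apply: leq_trans lt_m _.
  have h := @sorted_leq_nth _ geq geq_tr (fun x => leqnn x) 0%N la la_s.
  by apply: (h _ _ _ _ le_i); rewrite inE -?has_find.
have conjE m : (count (fun x => (m < x)%N) la == j) =
    (part la j.+1 <= m < part la j)%N.
  rewrite lt_count eqn_leq andbC -{1}(prednK j0) find_gt prednK // andbC.
  by congr andb; rewrite leqNgt find_gt -leqNgt.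
have le_jS : (part la j.+1 <= part la j)%N by exact: part_nonincr.
have le_j1 : (part la j <= part la 1)%N.
  clear -j0 la_p; elim: j j0 => // [] [|j] // IH _.
  by apply: leq_trans (IH isT); apply: part_nonincr.
rewrite /mult /conj_part /mkseq count_map.
rewrite (@eq_count _ _ (fun m => part la j.+1 <= m < part la j)%N); last first.
  by move=> m; rewrite /= conjE.
have count_iota a b N : (a <= b)%N -> (b <= N)%N ->
    count (fun m => a <= m < b)%N (iota 0 N) = (b - a)%N.
  move=> le_ab le_bN.
  rewrite -(subnKC le_bN) iotaD count_cat add0n.
  have -> : iota 0 b = iota 0 a ++ iota a (b - a) by rewrite -iotaD subnKC.
  rewrite count_cat.
  rewrite (@eq_in_count _ _ pred0 (iota 0 a)); last first.
    by move=> m; rewrite mem_iota add0n /= => lt_m; rewrite leqNgt lt_m.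
  rewrite (@eq_in_count _ _ predT (iota a (b - a))); last first.
    by move=> m; rewrite mem_iota subnKC.
  rewrite (@eq_in_count _ _ pred0 (iota b _)); last first.
    by move=> m; rewrite mem_iota /= => /andP[le_m _]; rewrite ltnNge le_m andbF.
  by rewrite !count_pred0 count_predT size_iota add0n addn0.
exact: count_iota.
Qed.

Lemma zw_labels_bounded (F : fieldType) (q : F) (rxi rs : nat -> F) (n L : nat)
    (kappa : 'I_n -> F) (la mu : seq nat) (a : 'I_n -> nat)
    (v : 'I_n.+1 -> 'I_L -> nat) (h : 'I_n -> 'I_L.+1 -> nat) :
  is_part la -> zw_boundary la mu a v h -> zw_weight q rxi rs kappa v h != 0 ->
  (forall r c, (v r c <= part la 1)%N) /\ (forall r c, (h r c <= part la 1)%N).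
Proof.
move=> la_p /and4P[/forallP v0 _ _ /forallP hL] w0.
have loc (r : 'I_n) (c : 'I_L) :
    (v (lift ord0 r) c + h r (widen_ord (leqnSn L) c)
      = v (widen_ord (leqnSn n) r) c + h r (lift ord0 c))%N
    /\ (h r (lift ord0 c) <= v (lift ord0 r) c)%N.
  move: w0; rewrite /zw_weight => /prodf_neq0/(_ r isT).
  move=> /prodf_neq0/(_ c isT); rewrite /vertexW.
  by case: ifP => [/andP[/eqP]|_] //; rewrite eqxx.
have row (r : 'I_n) : (\sum_(c < L) v (lift ord0 r) c + h r ord0
    = \sum_(c < L) v (widen_ord (leqnSn n) r) c)%N.
  have hsum : (h r ord0 + \sum_(c < L) h r (lift ord0 c)
      = \sum_(c < L) h r (widen_ord (leqnSn L) c))%N.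
    by rewrite -big_ord_recl big_ord_recr /= (eqP (hL r)) addn0.
  apply/eqP; rewrite -(eqn_add2r (\sum_(c < L) h r (lift ord0 c))) -addnA hsum.
  by rewrite -!big_split /=; apply/eqP/eq_bigr => c _; case: (loc r c).
have vsum m (r : 'I_n.+1) : r = m :> nat ->
    (\sum_(c < L) v r c <= part la 1)%N.
  elim: m r => [|m IH] r rE.
    have -> : r = ord0 by apply: val_inj.
    have le_part k : (part la k.+2 <= part la k.+1)%N by apply: part_nonincr.
    have : (\sum_(c < L) v ord0 c + part la L.+1 = part la 1)%N.
      rewrite (eq_bigr (fun c : 'I_L => part la c.+1 - part la c.+2)%N).
        elim: (L) => [|k IH]; first by rewrite big_ord0.
        by rewrite big_ord_recr /= -addnA subnK.
      by move=> c _; rewrite (eqP (v0 c)) mult_conj_part.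
    by move=> <-; apply: leq_addr.
  have lt_mn : (m < n)%N by rewrite -ltnS -rE.
  have -> : r = lift ord0 (Ordinal lt_mn) by apply: val_inj; rewrite /= rE.
  apply: leq_trans (IH (widen_ord (leqnSn n) (Ordinal lt_mn)) _) => //.
  by rewrite -row leq_addr.
have vle r c : (v r c <= part la 1)%N.
  by apply: leq_trans (vsum _ r erefl); rewrite (bigD1 c) //= leq_addr.
split=> // r c; have [->|c0] := eqVneq c ord0.
  apply: leq_trans (vsum _ (widen_ord (leqnSn n) r) erefl).
  by rewrite -row leq_addl.
case: (unliftP ord0 c) c0 => [c' -> _|-> /eqP //].
exact: leq_trans (loc r c').2 (vle _ _).
Qed.

(* Main.v *)
Require Import Defs.
From mathcomp Require Import all_boot all_order all_algebra.
From mathcomp Require Import fingroup perm.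
From mathcomp Require Import mpoly.
From mathcomp Require Import zify ring.

(* Put eta_i = xi_i s_i and rho_c = s_c / xi_c.  The vertex in row r and column
   c has t^2 = eta_(r+c) / kappa_r and s^2 / t^2 = kappa_r rho_c, so each row is
   polynomial in kappa_r: the powers of kappa_r rho_c clear the denominators of
   (eta_(r+c) / kappa_r; q)_l.

   Symmetry is reduced to exchanging kappa_1 and kappa_2 in two adjacent rows
   with fixed top and bottom.  A triangular matrix exchR of q-Hahn weights,
   depending on the column c only through eta_(c+1), moves particles between
   the horizontal edges of the two rows and satisfies a Yang-Baxter relation
   with the column weights; it acts trivially past the last column and turns
   the weights of the left boundary for (kappa_1, kappa_2) into those for
   (kappa_2, kappa_1).  After the common factors are removed, the Yang-Baxter
   relation is Sears' transformation of a terminating balanced 4phi3, which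
   follows from two applications of the q-Saalschuetz summation. *)

Set Implicit Arguments.
Unset Strict Implicit.
Unset Printing Implicit Defensive.

Import GRing.Theory.
Local Open Scope ring_scope.

(** * q-Saalschuetz and Sears *)

Section QPoch.
Variables (F : fieldType).
Implicit Types (q x : F).

Lemma qpoch0 q x : qpoch q x 0 = 1.
Proof. by rewrite /qpoch big_ord0. Qed.

Lemma qpochSr q x n : qpoch q x n.+1 = qpoch q x n * (1 - x * q ^+ n).
Proof. by rewrite /qpoch big_ord_recr. Qed.

Lemma qpochD q x m n : qpoch q x (m + n) = qpoch q x m * qpoch q (x * q ^+ m) n.
Proof.
elim: n => [|n IH]; first by rewrite addn0 qpoch0 mulr1.
by rewrite addnS !qpochSr IH exprD !mulrA.
Qed.

Lemma qpochS q x n : qpoch q x n.+1 = (1 - x) * qpoch q (x * q) n.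
Proof. by rewrite -add1n qpochD qpochSr qpoch0 expr0 expr1 mulr1 mul1r. Qed.

Lemma qpoch_neq0 q x n : (forall i, x * q ^+ i != 1) -> qpoch q x n != 0.
Proof.
by move=> h; apply/prodf_neq0 => i _; rewrite subr_eq0 eq_sym.
Qed.

Lemma qpochx0 q n : qpoch q 0 n = 1.
Proof. by apply: big1 => i _; rewrite mul0r subr0. Qed.

(** Meaningful for i <= n only: beyond that the truncated subtraction does not give 0, so uses below
    test the range separately. *)
Definition qbin q n i : F := qpoch q q n / (qpoch q q i * qpoch q q (n - i)).

Section Root.
Variable q : F.
Hypothesis q_nroot : forall k, (0 < k)%N -> q ^+ k != 1.

Lemma qpochqq_neq0 n : qpoch q q n != 0.
Proof. by apply: qpoch_neq0 => i; rewrite -exprS q_nroot. Qed.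

Lemma onemX_neq0 k : 1 - q ^+ k.+1 != 0.
Proof. by rewrite subr_eq0 eq_sym q_nroot. Qed.

Lemma qbinn0 n : qbin q n 0 = 1.
Proof. by rewrite /qbin qpoch0 mul1r subn0 divff // qpochqq_neq0. Qed.

Lemma qbinnn n : qbin q n n = 1.
Proof. by rewrite /qbin subnn qpoch0 mulr1 divff // qpochqq_neq0. Qed.

Lemma qpochqqS n : qpoch q q n.+1 = qpoch q q n * (1 - q ^+ n.+1).
Proof. by rewrite qpochSr -exprS. Qed.

(* The denominator-free form of the q-Saalschuetz sum, whose lower parameter is
   A B D. *)
Lemma q_saalschuetz (A B D : F) n :
  \sum_(i < n.+1) qbin q n i * (qpoch q A i * qpoch q B i * qpoch q D (n - i)
     * D ^+ i * qpoch q (A * B * D * q ^+ i) (n - i))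
  = qpoch q (A * D) n * qpoch q (B * D) n.
Proof.
elim: n => [|n IH].
  by rewrite big_ord1 !qpoch0 expr0 qbinn0 !mulr1.
pose E n i := qpoch q A i * qpoch q B i * qpoch q D (n - i)
     * D ^+ i * qpoch q (A * B * D * q ^+ i) (n - i).
(* The Wilf-Zeilberger companion of the summand. *)
pose G i := if i is i'.+1 then - q ^+ (n - i') * qbin q n i' *
   (qpoch q A i'.+1 * qpoch q B i'.+1 * qpoch q D (n - i') * D ^+ i'.+1
    * qpoch q (A * B * D * q ^+ i') (n - i')) else 0.
(* The factor in front is the ratio of the closed forms at n + 1 and n, so the sums obey the same
   recurrence up to a telescoping term. *)
have step i : (i < n.+1)%N ->
    qbin q n.+1 i * E n.+1 i
    = (1 - A * D * q ^+ n) * (1 - B * D * q ^+ n) * (qbin q n i * E n i)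
      + (G i.+1 - G i).
  rewrite ltnS => le_in; rewrite /E /G -(subnK le_in); move: (n - i)%N => d; clear le_in.
  have q0 := qpochqq_neq0.
  case: i => [|i].
    rewrite addn0 !subn0 !qbinn0 !qpoch0 subr0 expr0.
    rewrite (qpochSr _ _ d) (qpochSr _ (A * B * D * 1) d) !(qpochS _ _ 0) !qpoch0.
    ring.
  have -> : ((d + i.+1).+1 - i.+1 = d.+1)%N by lia.
  have -> : (d + i.+1 - i.+1 = d)%N by lia.
  have -> : (d + i.+1 - i = d.+1)%N by lia.
  rewrite [qpoch q (_ * q ^+ i) d.+1]qpochS /qbin.
  have -> : ((d + i.+1).+1 - i.+1 = d.+1)%N by lia.
  have -> : (d + i.+1 - i.+1 = d)%N by lia.
  have -> : (d + i.+1 - i = d.+1)%N by lia.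
  rewrite -(mulrA _ (q ^+ i) q) -exprSr.
  rewrite [qpoch q D d.+1]qpochSr [qpoch q (_ * q ^+ i.+1) d.+1]qpochSr.
  rewrite (qpochSr _ A i.+1) (qpochSr _ B i.+1).
  rewrite !(qpochqqS (d + i.+1)) !(qpochqqS d) (qpochqqS i).
  move: (onemX_neq0 d) (onemX_neq0 i) (q0 d) (q0 i) (q0 (d + i.+1)%N).
  rewrite !exprS !exprD !exprS => *.
  by field; apply/and4P; split.
(* The term of index n + 1, which [step] does not cover, cancels the surviving boundary term
   [G n.+1]. *)
rewrite big_ord_recr /= (eq_bigr (fun i : 'I_n.+1 =>
  (1 - A * D * q ^+ n) * (1 - B * D * q ^+ n) * (qbin q n i * E n i)
      + (G i.+1 - G i))); last by move=> i _; rewrite -step.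
rewrite big_split /= -mulr_sumr IH -(big_mkord xpredT (fun i => G i.+1 - G i)).
rewrite telescope_sumr // /G subr0 !subnn !qpoch0 !qbinnn !expr0.
rewrite (qpochSr _ (A * D)) (qpochSr _ (B * D)); ring.
Qed.

End Root.

(** * Falling products in base q^-1 and Sears' transformation *)

Section NonzeroRoot.
Variable q : F.
Hypothesis q_nroot : forall k, (0 < k)%N -> q ^+ k != 1.
Hypothesis q_neq0 : q != 0.

Let qV_nroot k : (0 < k)%N -> q^-1 ^+ k != 1.
Proof. by move=> k0; rewrite exprVn invr_eq1 q_nroot. Qed.

(* In base q^-1 the symbol at q^a is the falling product
   (1 - q^a) (1 - q^(a-1)) ..., which vanishes past a factors. *)
Lemma qpochV_fall a i : (i <= a)%N ->
  qpoch q^-1 (q ^+ a) i * qpoch q q (a - i) = qpoch q q a.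
Proof.
elim: i => [|i IH] lt_ia; first by rewrite qpoch0 mul1r subn0.
rewrite -IH 1?ltnW // qpochSr -mulrA; congr (_ * _).
have -> : (a - i = (a - i.+1).+1)%N by lia.
rewrite qpochqqS mulrC; congr (_ * (1 - _)).
by rewrite exprVn -(subnK (ltnW lt_ia)) exprD mulfK ?expf_neq0 // ;
  congr (_ ^+ _); lia.
Qed.

Lemma qpochV_eq0 a i : (a < i)%N -> qpoch q^-1 (q ^+ a) i = 0.
Proof.
move=> lt_ai; rewrite -(subnKC lt_ai) qpochD qpochSr exprVn mulfV ?expf_neq0 //.
by rewrite subrr mulr0 mul0r.
Qed.

(** Each factor 1 - q^-i equals -q^-i (1 - q^i), and the exponents 1, ..., n add up to the binomial
    coefficient. *)
Lemma qpochqqV n :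
  qpoch q^-1 q^-1 n = (-1) ^+ n * q^-1 ^+ 'C(n.+1, 2) * qpoch q q n.
Proof.
elim: n => [|n IH]; first by rewrite !qpoch0 bin_small // !expr0 !mulr1.
have -> : 'C(n.+2, 2) = ('C(n.+1, 2) + n.+1)%N by rewrite binS bin1.
rewrite qpochSr IH qpochqqS exprD -(exprS _ n) (exprSr (-1)).
have: q ^+ n.+1 != 0 by rewrite expf_neq0.
by rewrite !exprVn => h; field; rewrite h expf_neq0.
Qed.

Lemma qbinV i m :
  qbin q^-1 (i + m) i * q ^+ (i * m) = qbin q (i + m) i.
Proof.
rewrite /qbin addKn !qpochqqV.
have -> : 'C((i + m).+1, 2) = ('C(i.+1, 2) + 'C(m.+1, 2) + i * m)%N.
  elim: m => [|m IH]; first by rewrite !addn0 muln0 addn0.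
  by rewrite addnS !(binS _.+1 1) !bin1 IH; lia.
rewrite !exprVn !exprD.
by field; rewrite !(qpochqq_neq0 q_nroot) !expf_neq0 // oppr_eq0 oner_eq0.
Qed.

(** The part of the 4phi3 term free of a, b and e. The falling products vanish for j > x or j > N -
    y, so sums over j <= N terminate by themselves. *)
Definition sears_coef (N x y j : nat) : F :=
  qpoch q q (N - j) * qpoch q^-1 (q ^+ x) j * qpoch q^-1 (q ^+ (N - y)) j
  / qpoch q q j.

(** The part carrying a, b and e. Its truncated subtractions are harmless, since [sears_coef] is
    zero wherever they matter. *)
Definition sears_fun (a b e : F) (N x y j : nat) : F :=
  a ^+ (x - j) * b ^+ j * qpoch q (e / a) (x - j) * qpoch q (a / b) j
  * qpoch q b (N - y - j) / qpoch q e (N - j).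

(** This is q-Saalschuetz in base q^-1 at A = q^y, B = q^(N-y-d), D = q^d: its right-hand side holds
    the falling products for (y + d, y), while A and B give those for the exchanged pair. *)
Lemma sears_coef_expand N y d j : (y + d <= N)%N -> (j <= N)%N ->
  sears_coef N (y + d) y j = \sum_(i < j.+1) sears_coef N y (y + d) i
    * (if (j - i <= d)%N then q ^+ (i * (d - (j - i))) * qbin q d (j - i) else 0).
Proof.
move=> le_xN le_jN.
have := q_saalschuetz qV_nroot (q ^+ y) (q ^+ (N - (y + d))) (q ^+ d) j.
rewrite -!exprD; have -> : (N - (y + d) + d = N - y)%N by lia.
have -> : (y + (N - (y + d)) + d = N)%N by lia.
move=> /(congr1 (fun z => qpoch q q (N - j) / qpoch q q j * z)).
rewrite mulr_sumr => h.
transitivity (qpoch q q (N - j) / qpoch q q j *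
   (qpoch q^-1 (q ^+ (y + d)) j * qpoch q^-1 (q ^+ (N - y)) j)).
  by rewrite /sears_coef; ring.
rewrite -{}h; apply: eq_bigr => -[i /=]; rewrite ltnS => le_ij _.
(* [r] is the stretch of the falling product of q^N between its first i and its first j factors. *)
rewrite /sears_coef; set r := qpoch _ (_ * _) _.
have rE : r * qpoch q q (N - j) = qpoch q q (N - i).
  have h := qpochV_fall le_jN; have h' := qpochV_fall (leq_trans le_ij le_jN).
  have := h; rewrite -h' -{1}(subnKC le_ij) qpochD -/r -mulrA.
  apply: mulfI; have := qpochqq_neq0 q_nroot N.
  by rewrite -h' mulf_eq0 negb_or => /andP[].
have rN : r = qpoch q q (N - i) / qpoch q q (N - j).
  by rewrite -rE mulfK // (qpochqq_neq0 q_nroot).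
rewrite {}rN {rE}; case: ifP => [le_d|/negbT]; last first.
  by rewrite -ltnNge => /qpochV_eq0->; rewrite !(mul0r, mulr0).
have dE := qpochV_fall le_d.
have dN : qpoch q^-1 (q ^+ d) (j - i) = qpoch q q d / qpoch q q (d - (j - i)).
  by rewrite -dE mulfK // (qpochqq_neq0 q_nroot).
rewrite {}dN {dE}; move: (qbinV i (j - i)); rewrite subnKC // => bE.
have qx : q ^+ (i * (j - i)) != 0 by rewrite expf_neq0.
have bN : qbin q^-1 j i = qbin q j i / q ^+ (i * (j - i)).
  by rewrite -bE mulfK.
rewrite {}bN {bE} -exprM [(d * i)%N]mulnC (mulnBr i d).
have -> : q ^+ (i * d) = q ^+ (i * d - i * (j - i)) * q ^+ (i * (j - i)).
  by rewrite -exprD subnK // leq_mul2l le_d orbT.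
by rewrite /qbin; field; rewrite !(qpochqq_neq0 q_nroot) qx.
Qed.

Lemma sum_window (f : nat -> F) N i d : (i + d <= N)%N ->
  \sum_(j < N.+1) (if (i <= j <= i + d)%N then f j else 0)
  = \sum_(m < d.+1) f (i + m)%N.
Proof.
move=> le_N; rewrite -(big_mkord xpredT
  (fun j => if (i <= j <= i + d)%N then f j else 0)).
rewrite (big_cat_nat (n := i)) /=; try lia.
rewrite (big_cat_nat (n := (i + d).+1) (m := i)) /=; try lia.
rewrite big_nat_cond big1 => [|j]; last by case/andP; case: ifP => //; lia.
rewrite [X in _ + (_ + X)]big_nat_cond [X in _ + (_ + X)]big1; last first.
  by move=> j; case/andP; case: ifP => //; lia.
rewrite add0r addr0 -addnS -{1}[i]add0n big_addn addKn
  -(big_mkord xpredT (fun m => f (i + m)%N)).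
rewrite [LHS]big_nat_cond [RHS]big_nat_cond; apply: eq_bigr => j.
by case/andP; rewrite addnC; case: ifP => //; lia.
Qed.

(** After the coefficient is expanded by [sears_coef_expand] and the sums are exchanged, the inner
    sum over j is again a q-Saalschuetz sum, now in base q. *)
Lemma sears_shift (a b e : F) N y d : a != 0 -> b != 0 ->
  (forall i, qpoch q e i != 0) -> (y + d <= N)%N ->
  \sum_(j < N.+1) sears_coef N (y + d) y j * sears_fun a b e N (y + d) y j
  = b ^+ d * qpoch q (e / b * q ^+ y) d * qpoch q (a * q ^+ (N - (y + d))) d
    * \sum_(i < N.+1) sears_coef N y (y + d) i * sears_fun a b e N y (y + d) i.
Proof.
move=> a0 b0 e0 le_xN.
pose K i j := if (i <= j <= i + d)%N then
  q ^+ (i * (d - (j - i))) * qbin q d (j - i) * sears_fun a b e N (y + d) y j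
  else 0.
transitivity (\sum_(j < N.+1) \sum_(i < N.+1) sears_coef N y (y + d) i * K i j).
  apply: eq_bigr => -[j /=]; rewrite ltnS => le_jN _.
  rewrite sears_coef_expand // mulr_suml (big_ord_widen N.+1 (fun i =>
    sears_coef N y (y + d) i * (if (j - i <= d)%N then
    q ^+ (i * (d - (j - i))) * qbin q d (j - i) else 0)
    * sears_fun a b e N (y + d) y j)) ?ltnS //.
  rewrite big_mkcond; apply: eq_bigr => i _; rewrite /K ltnS -leq_subLR.
  by case: leqP => _ /=; rewrite ?mulr0 //; case: ifP; rewrite ?(mulr0, mul0r) // !mulrA.
rewrite exchange_big mulr_sumr; apply: eq_bigr => -[i /=]; rewrite ltnS => le_iN _.
rewrite -mulr_sumr.
(* Outside i <= y and i <= N - (y + d) the coefficient vanishes; inside, the window from i to i + d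
   fits below N. *)
have [lt_yi|le_iy] := ltnP y i.
  by rewrite /sears_coef qpochV_eq0 // !(mul0r, mulr0).
have [lt_xi|le_ix] := ltnP (N - (y + d)) i.
  by rewrite /sears_coef (qpochV_eq0 lt_xi) !(mul0r, mulr0).
rewrite mulrCA; congr (_ * _).
rewrite (sum_window (fun j => q ^+ (i * (d - (j - i))) * qbin q d (j - i)
    * sears_fun a b e N (y + d) y j)); last by lia.
(* The parameters are the points from which the symbols of [sears_fun] continue once their values at
   the target term i are split off. *)
have := q_saalschuetz q_nroot (e / a * q ^+ (y - i)) (b * q ^+ (N - (y + d) - i))
   (a / b * q ^+ i) d.
have -> : e / a * q ^+ (y - i) * (a / b * q ^+ i) = e / b * q ^+ y.
  by rewrite -{2}(subnK le_iy) exprD; field; rewrite a0 b0.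
have -> : b * q ^+ (N - (y + d) - i) * (a / b * q ^+ i) = a * q ^+ (N - (y + d)).
  by rewrite -{2}(subnK le_ix) exprD; field; rewrite b0.
have -> : e / a * q ^+ (y - i) * (b * q ^+ (N - (y + d) - i)) * (a / b * q ^+ i)
   = e * q ^+ (N - d - i).
  have -> : (N - d - i = y - i + (N - (y + d) - i) + i)%N by lia.
  by rewrite !exprD; field; rewrite a0 b0.
move=> h; rewrite -(mulrA (b ^+ d)) -{}h mulr_sumr mulr_suml.
rewrite -(big_mkord xpredT (fun m => q ^+ (i * (d - (i + m - i))) *
   qbin q d (i + m - i) * sears_fun a b e N (y + d) y (i + m))).
(* The window is reversed, j = i + d - m: the symbols of e / a and b lengthen with m, that of a / b
   shortens. *)
rewrite big_nat_rev /= big_mkord; apply: eq_bigr => -[m /=]; rewrite ltnS => le_md _.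
rewrite add0n subSS addKn subKn // /sears_fun.
have -> : (y + d - (i + (d - m)) = y - i + m)%N by lia.
have -> : (N - y - (i + (d - m)) = N - (y + d) - i + m)%N by lia.
have -> : (N - i = N - (i + (d - m)) + (d - m))%N by lia.
rewrite !qpochD.
have -> : (N - (i + (d - m)) = N - d - i + m)%N by lia.
have bE : qbin q d (d - m) = qbin q d m.
  by rewrite /qbin subKn // [X in _ / X]mulrC.
rewrite bE exprMn -exprM !exprD.
have -> : b ^+ d = b ^+ (d - m) * b ^+ m by rewrite -exprD subnK.
rewrite -(mulrA e (q ^+ (N - d - i))) -[q ^+ (N - d - i) * _]exprD.
have := e0 (N - d - i + m + (d - m))%N; rewrite qpochD mulf_eq0 negb_or => /andP[h1 h2].
rewrite expr_div_n.
by field; rewrite h1 h2 expf_neq0.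
Qed.

(* This is the transformation of
   4phi3 (q^-x, q^(y-N), q^(1-N)/e, a/b; q^(1-x) a/e, q^(1-N+y)/b, q^-N; q, q)
   that exchanges x and y. *)
Lemma sears (a b e : F) (N x y : nat) : a != 0 -> b != 0 ->
  (forall i, qpoch q e i != 0) -> (x <= N)%N -> (y <= N)%N ->
  qpoch q a (N - x) * b ^+ y * qpoch q (e / b) y *
   (\sum_(j < N.+1) sears_coef N x y j * sears_fun a b e N x y j)
  = qpoch q a (N - y) * b ^+ x * qpoch q (e / b) x *
   (\sum_(j < N.+1) sears_coef N y x j * sears_fun a b e N y x j).
Proof.
move=> a0 b0 e0; wlog le_yx : x y / (y <= x)%N.
  move=> th hx hy; case: (leqP y x) => [|/ltnW] le; first exact: th.
  by rewrite -(th y x).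
move=> + _; rewrite -(subnKC le_yx); move: (x - y)%N => d le_xN.
rewrite sears_shift // exprD qpochD.
have -> : (N - y = N - (y + d) + d)%N by lia.
rewrite qpochD; ring.
Qed.

End NonzeroRoot.
End QPoch.

(** * The Yang-Baxter relation *)

Section YangBaxter.
Variables (F : fieldType) (q : F).
Hypothesis q_nroot : forall k, (0 < k)%N -> q ^+ k != 1.
Hypothesis q_neq0 : q != 0.

(* The weight vertexW with t^2 = e / kap and s^2 = e rho. *)
Definition colW (kap e rho : F) := vertexW q (e / kap) (e * rho).

Lemma colWE kap e rho i j k l : kap != 0 -> e != 0 ->
  (i + j = k + l)%N -> (l <= i)%N ->
  colW kap e rho i j k l = (kap * rho) ^+ l
    * (qpoch q (kap * rho) (i - l) * qpoch q (e / kap) l / qpoch q (e * rho) i)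
    * qbin q i l.
Proof.
move=> k0 e0 ijkl le_li; rewrite /colW /vertexW ijkl eqxx le_li /qbin.
have -> : e * rho / (e / kap) = kap * rho by field; rewrite e0 k0.
by rewrite [qpoch q q l * _]mulrC.
Qed.

Lemma colW_eq0 kap e rho i j k l :
  ~~ ((i + j == k + l) && (l <= i))%N -> colW kap e rho i j k l = 0.
Proof. by rewrite /colW /vertexW => /negbTE->. Qed.

(* The R-matrix: it moves p - p' particles from the second row to the first. *)
Definition exchR (kap1 kap2 e : F) p p' : F :=
  if (p' <= p)%N then (kap1 / kap2) ^+ p' * qpoch q (e / kap1) p'
    * qpoch q (kap1 / kap2) (p - p') / qpoch q (e / kap2) p * qbin q p p'
  else 0.

Lemma sum_ord_trunc (f : nat -> F) n N : (n <= N)%N ->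
  (forall j, (n <= j < N)%N -> f j = 0) ->
  \sum_(j < N) f j = \sum_(j < n) f j.
Proof.
move=> le_nN f0; rewrite -(subnKC le_nN) big_split_ord /= [X in _ + X]big1 ?addr0 //.
by move=> [j /= lt_j] _; rewrite f0 // leq_addr -ltn_subRL.
Qed.

Lemma sum_ord_shift (f : nat -> F) a n : (forall j, (j < a)%N -> f j = 0) ->
  \sum_(j < a + n) f j = \sum_(j < n) f (a + j)%N.
Proof.
by move=> f0; rewrite big_split_ord /= [X in X + _]big1 ?add0r // => j _; rewrite f0.
Qed.

(** The labels x and y enter the column in the upper and lower row, k and m are its top and bottom
    labels, and y' leaves the lower row after the exchange; conservation forces the rest. Both sides
    are multiples of the two Sears sums with a = kap1 rho, b = kap2 rho, e = e1 rho. *)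
Lemma yang_baxter (kap1 kap2 e1 e2 rho : F) (x y k m y' : nat) :
  kap1 != 0 -> kap2 != 0 -> e1 != 0 -> e2 != 0 -> rho != 0 ->
  (forall i, qpoch q (e1 * rho) i != 0) ->
  (forall i, qpoch q (e2 * rho) i != 0) ->
  (forall i, qpoch q (e1 / kap2) i != 0) ->
  (forall i, qpoch q (e2 / kap2) i != 0) ->
  (y' <= m)%N ->
  \sum_(p < m.+1) colW kap1 e1 rho (m + y - p) x k (m + y - p + x - k)
     * colW kap2 e2 rho m y (m + y - p) p * exchR kap1 kap2 e2 p y'
  = \sum_(p < y.+1) exchR kap1 kap2 e1 y p
     * (colW kap2 e1 rho (m + p - y') (x + y - p) k (m + p - y' + (x + y - p) - k)
        * colW kap1 e2 rho m p (m + p - y') y').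
Proof.
move=> k10 k20 e10 e20 r0 e1r e2r e1k e2k.
have qq0 := qpochqq_neq0 q_nroot.
move=> le_y'm; have [A mE] : exists A, m = (y' + A)%N by exists (m - y')%N; lia.
(* Let x' be the label leaving the upper row. Unless 0 <= x' <= N, every term on both sides
   vanishes. *)
have [bad|good] := ltnP (m + x + y) (k + y').
  rewrite !big1 // => -[p /= hp] _.
    by rewrite [X in _ * (X * _)]colW_eq0 ?mul0r ?mulr0 //; lia.
  rewrite /exchR; case: leqP => le; last by rewrite mulr0.
  by rewrite colW_eq0 ?mul0r //; lia.
have [x' x'E] : exists x', (k + y' + x' = m + x + y)%N.
  by exists (m + x + y - (k + y'))%N; lia.
pose N := (A + y)%N; have NyA : (N - y = A)%N by rewrite addnK.
have [bad2|le_x'N] := ltnP N x'.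
  rewrite !big1 // => -[p /= hp] _.
    by rewrite [X in _ * (X * _)]colW_eq0 ?mul0r ?mulr0 //; lia.
  by rewrite colW_eq0 ?mul0r //; lia.
have kE : (k = N - x' + x)%N by lia.
set al := kap1 * rho; set be := kap2 * rho; set e := e1 * rho.
have al0 : al != 0 by rewrite mulf_neq0.
have be0 : be != 0 by rewrite mulf_neq0.
have ea : e1 / kap1 = e / al by rewrite /e /al; field; rewrite r0 k10.
have eb : e1 / kap2 = e / be by rewrite /e /be; field; rewrite r0 k20.
have ab : kap1 / kap2 = al / be by rewrite /al /be; field; rewrite r0 k20.
pose S x y := \sum_(j < N.+1) sears_coef q N x y j * sears_fun q al be e N x y j.
have := @sears _ q q_nroot q_neq0 al be e N x' y al0 be0 e1r le_x'N (leq_addl _ _).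
rewrite -!/(S _ _).
have coef0 u v j : (j <= u)%N -> (j <= N - v)%N ->
  sears_coef q N u v j = qpoch q q (N - j) * qpoch q q u * qpoch q q (N - v)
   / (qpoch q q (u - j) * qpoch q q (N - v - j) * qpoch q q j).
  move=> h1 h2; rewrite /sears_coef -(qpochV_fall q_neq0 h1) -(qpochV_fall q_neq0 h2).
  by field; rewrite !qq0.
(* The factors common to both sides; after simplification e2 survives only here. *)
pose P := qpoch q (e2 / kap1) y' * qpoch q q m / qpoch q (e2 * rho) m
  / (qpoch q q y' * qpoch q q A) * al ^+ y'.
set SL := \sum_(p < m.+1) _; set SR := \sum_(p < y.+1) _.
(* The substitution is p = y' + j, since [exchR] vanishes for p < y'. *)
have -> : SL = P * qpoch q al (N - x') / (qpoch q q x' * qpoch q q (N - x')) * S x' y.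
  pose f p := colW kap1 e1 rho (m + y - p) x k (m + y - p + x - k)
     * colW kap2 e2 rho m y (m + y - p) p * exchR kap1 kap2 e2 p y'.
  rewrite /SL [LHS](_ : _ = \sum_(p < m.+1) f p) //.
  rewrite mE -addnS sum_ord_shift; last first.
    by move=> j lt_j; rewrite /f /exchR leqNgt lt_j mulr0.
  rewrite /S (@sum_ord_trunc (fun j => _ j * _ j) A.+1); last 2 first.
  - by rewrite ltnS leq_addr.
  - move=> j /andP[lt_j _]; rewrite /sears_coef.
    by rewrite (@qpochV_eq0 _ q q_neq0 (N - y)) ?NyA // !(mul0r, mulr0).
  rewrite mulr_sumr; apply: eq_bigr => -[j /=]; rewrite ltnS => le_jA _.
  have [lt_xj|le_jx] := ltnP x' j.
    rewrite /sears_coef (@qpochV_eq0 _ q q_neq0 x' j) // ?(mul0r, mulr0).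
    by rewrite /f [X in X * _ * _]colW_eq0 ?mul0r //; lia.
  rewrite coef0 ?NyA // /f /sears_fun.
  rewrite !colWE //; try lia.
  have -> : (m + y - (y' + j) + x - k = x' - j)%N by lia.
  have -> : (m + y - (y' + j) - (x' - j) = N - x')%N by lia.
  have -> : (m + y - (y' + j) = N - j)%N by lia.
  have -> : (m - (y' + j) = A - j)%N by lia.
  have -> : (N - y - j = A - j)%N by lia.
  rewrite /exchR leq_addr addKn /qbin addKn.
  have -> : (m - (y' + j) = A - j)%N by lia.
  have -> : (N - j - (x' - j) = N - x')%N by lia.
  rewrite -/al -/be -/e ea ab exprD expr_div_n.
  have := e1r (N - j)%N; rewrite -/e => eN.
  have bey : be ^+ y' != 0 by rewrite expf_neq0.
  rewrite /P; clearbody al be e; clear S SL SR coef0 f P.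
  field; rewrite !qq0 e2k e2r eN bey //.
(* Here the substitution is p = y - j. *)
have -> : SR = P * be ^+ x' / be ^+ y * qpoch q (e / be) x' / qpoch q (e / be) y
   * qpoch q al A / (qpoch q q x' * qpoch q q (N - x')) * S y x'.
  pose f p := exchR kap1 kap2 e1 y p
     * (colW kap2 e1 rho (m + p - y') (x + y - p) k (m + p - y' + (x + y - p) - k)
        * colW kap1 e2 rho m p (m + p - y') y').
  rewrite /SR [LHS](_ : _ = \sum_(p < y.+1) f p) //.
  rewrite -(big_mkord xpredT f) big_nat_rev /= big_mkord.
  rewrite /S (@sum_ord_trunc (fun j => _ j * _ j) y.+1); last 2 first.
  - by rewrite ltnS leq_addl.
  - move=> j /andP[lt_j _]; rewrite /sears_coef.
    by rewrite (@qpochV_eq0 _ q q_neq0 y) // !(mul0r, mulr0).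
  rewrite mulr_sumr; apply: eq_bigr => -[j /=]; rewrite ltnS => le_jy _.
  rewrite add0n subSS.
  have [lt_xj|le_jx] := ltnP (N - x') j.
    rewrite /sears_coef (@qpochV_eq0 _ q q_neq0 (N - x') j) // ?(mul0r, mulr0).
    by rewrite /f [X in _ * (X * _)]colW_eq0 ?(mul0r, mulr0) //; lia.
  rewrite coef0 // /f /sears_fun.
  rewrite !colWE //; try lia.
  have -> : (m + (y - j) - y' + (x + y - (y - j)) - k = x')%N by lia.
  have -> : (m + (y - j) - y' - x' = N - x' - j)%N by lia.
  have -> : (m + (y - j) - y' = N - j)%N by lia.
  have -> : (m - y' = A)%N by lia.
  rewrite /exchR leq_subr subKn // /qbin subKn //.
  have -> : (m - y' = A)%N by lia.
  have -> : (N - j - x' = N - x' - j)%N by lia.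
  rewrite -/al -/be -/e ea eb ab expr_div_n.
  have -> : be ^+ y = be ^+ (y - j) * be ^+ j by rewrite -exprD subnK.
  have := e1r (N - j)%N; rewrite -/e => eN.
  have := e1k y; rewrite eb => ey.
  have bey : be ^+ (y - j) != 0 by rewrite expf_neq0.
  have bej : be ^+ j != 0 by rewrite expf_neq0.
  rewrite /P; clearbody al be e; clear S SL SR coef0 f P.
  field; rewrite !qq0 ey e2r eN bey bej //.
rewrite NyA.
have h1 := e1k y; rewrite eb in h1.
have h2 : be ^+ y != 0 by rewrite expf_neq0.
move=> h.
apply: (mulIf h1); apply: (mulIf h2).
transitivity (P / (qpoch q q x' * qpoch q q (N - x')) *
  (qpoch q al (N - x') * be ^+ y * qpoch q (e / be) y * S x' y)).
  ring.
rewrite h; clearbody P S; field; rewrite h1 h2 !qq0 ?be0 //.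
Qed.
End YangBaxter.

(** * Exchanging adjacent rows *)

Section Matrices.
Variables (F : fieldType) (T : finType).

Lemma sum_row_mx m n1 n2 (f : 'M[T]_(m, n1 + n2) -> F) :
  \sum_A f A = \sum_B \sum_C f (row_mx B C).
Proof.
rewrite pair_bigA /= (reindex (fun p => row_mx p.1 p.2)) //=.
exists (fun A => (lsubmx A, rsubmx A)) => [[B C] _ /=|A _ /=].
  by rewrite row_mxKl row_mxKr.
exact: hsubmxK.
Qed.

Lemma sum_col_mx m1 m2 n (f : 'M[T]_(m1 + m2, n) -> F) :
  \sum_A f A = \sum_B \sum_C f (col_mx B C).
Proof.
rewrite pair_bigA /= (reindex (fun p => col_mx p.1 p.2)) //=.
exists (fun A => (usubmx A, dsubmx A)) => [[B C] _ /=|A _ /=].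
  by rewrite col_mxKu col_mxKd.
exact: vsubmxK.
Qed.

Lemma sum_mx11 (f : 'M[T]_1 -> F) : \sum_A f A = \sum_a f (const_mx a).
Proof.
rewrite (reindex (fun a => const_mx a)) //=.
exists (fun A : 'M_1 => A 0 0) => [a _|A _]; first by rewrite mxE.
by apply/matrixP => i j; rewrite !mxE !ord1.
Qed.

Lemma sum_rV0 (f : 'rV[T]_0 -> F) (V0 : 'rV[T]_0) : \sum_V f V = f V0.
Proof.
rewrite (bigD1 V0) //= big1 ?addr0 // => V /eqP[].
by apply/matrixP => i [].
Qed.

Lemma sum_flatmx n (f : 'M[T]_(0, n) -> F) (A0 : 'M[T]_(0, n)) : \sum_A f A = f A0.
Proof.
rewrite (bigD1 A0) //= big1 ?addr0 // => A /eqP[].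
by apply/matrixP => -[].
Qed.

Lemma sum_rV_cons n (f : 'rV[T]_n.+1 -> F) :
  \sum_V f V = \sum_a \sum_(V : 'rV[T]_n) f (row_mx (const_mx a : 'M_1) V).
Proof. by rewrite (@sum_row_mx 1 1 n f) sum_mx11. Qed.

End Matrices.

Section Lists.
Variables (B : nat).

(** Rows become lists so that row weights can be defined by recursion on the columns. *)
Definition rseq L (V : 'rV['I_B.+1]_L) : seq nat := [seq val (V 0 i) | i <- enum 'I_L].

Lemma size_rseq L (V : 'rV_L) : size (rseq V) = L.
Proof. by rewrite size_map size_enum_ord. Qed.

Lemma rseq_cons L (a : 'I_B.+1) (V : 'rV_L) :
  rseq (row_mx (const_mx a : 'M_1) V) = val a :: rseq V.
Proof.
have r0 : row_mx (const_mx a : 'M_1) V 0 (lshift L ord0) = a.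
  by rewrite row_mxEl mxE.
have rS i : row_mx (const_mx a : 'M_1) V 0 (rshift 1 i) = V 0 i.
  by rewrite row_mxEr.
rewrite /rseq enum_ordSl /= -map_comp; congr (_ :: _).
  by rewrite -[in RHS]r0; congr (nat_of_ord (fun_of_matrix _ _ _)); apply: val_inj.
apply: eq_map => i /=.
by rewrite -[in RHS]rS; congr (nat_of_ord (fun_of_matrix _ _ _)); apply: val_inj.
Qed.

Lemma rseq0 (V : 'rV_0) : rseq V = [::].
Proof. by apply/nilP; rewrite /nilp size_rseq. Qed.

End Lists.

(** * Transport of the R-matrix through two rows, and permutation of a chain of rows *)

Section Chains.
Variables (F : fieldType) (q : F).
Hypothesis q_nroot : forall k, (0 < k)%N -> q ^+ k != 1.
Hypothesis q_neq0 : q != 0.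
Variables (eta rho : nat -> F).
Hypothesis eta_neq0 : forall c, eta c != 0.
Hypothesis rho_neq0 : forall c, rho c != 0.
Hypothesis eta_rho : forall r c i, qpoch q (eta (r + c) * rho c) i != 0.

(** Keeps the denominators of [exchR] nonzero. *)
Definition regular kap := kap != 0 /\ forall c i, qpoch q (eta c / kap) i != 0.

(* ks and ms list the top and bottom labels of the columns c, c + 1, ...; x is
   the label entering column c from the left. *)
Fixpoint row_weight r kap (c x : nat) (ks ms : seq nat) {struct ks} : F :=
  match ks, ms with
  | k :: ks', m :: ms' => colW q kap (eta (r + c)) (rho c) m x k (m + x - k)
      * row_weight r kap c.+1 (m + x - k)%N ks' ms'
  | [::], [::] => (x == 0%N)%:R
  | _, _ => 0
  end.

(* Two rows summed over the labels m + y - p between them, p being the label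
   leaving the column in the lower row. *)
Fixpoint pair_weight r kap1 kap2 (c x y : nat) (ks ms : seq nat) {struct ks} : F :=
  match ks, ms with
  | k :: ks', m :: ms' => \sum_(p < m.+1)
      colW q kap1 (eta (r + c)) (rho c) (m + y - p) x k (m + y - p + x - k)
      * colW q kap2 (eta (r.+1 + c)) (rho c) m y (m + y - p) p
      * pair_weight r kap1 kap2 c.+1 (m + y - p + x - k)%N p ks' ms'
  | [::], [::] => ((x == 0%N) && (y == 0%N))%:R
  | _, _ => 0
  end.

Lemma row_weight_conserve r kap c x ks ms :
  row_weight r kap c x ks ms != 0 -> (x + sumn ms = sumn ks)%N.
Proof.
elim: ks ms c x => [|k ks IH] [|m ms] c x /=; rewrite ?eqxx //.
  by case: x => // x; rewrite mulr0n eqxx.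
rewrite mulf_eq0 negb_or => /andP[w /IH h].
have /andP[/eqP e _] : ((m + x == k + (m + x - k)) && (m + x - k <= m))%N.
  by apply: contraNT w => /colW_eq0->.
lia.
Qed.

Lemma pair_weight_conserve r kap1 kap2 c x y ks ms :
  pair_weight r kap1 kap2 c x y ks ms != 0 -> (x + y + sumn ms = sumn ks)%N.
Proof.
elim: ks ms c x y => [|k ks IH] [|m ms] c x y /=; rewrite ?eqxx //.
  by case: x y => [|x] [|y] //=; rewrite mulr0n eqxx.
move=> nz; apply/eqP; apply: contraNT nz => ne; apply/eqP.
rewrite big1 // => -[p /= lt_p] _.
have [->|nz] := eqVneq (pair_weight r kap1 kap2 c.+1 (m + y - p + x - k) p ks ms) 0.
  by rewrite mulr0.
have h := IH _ _ _ _ nz.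
by rewrite [X in X * _ * _]colW_eq0 ?mul0r //; lia.
Qed.

(** By induction on the columns: the hypothesis puts an R-matrix to the right of column c, and
    [yang_baxter] moves it to the left. The parameters fit because eta (r + (c + 1)) is also the
    parameter of the lower row in column c. *)
Lemma pair_weight_exchange r kap1 kap2 c x y ks ms :
  regular kap1 -> regular kap2 ->
  pair_weight r kap1 kap2 c x y ks ms
  = \sum_(p < y.+1) exchR q kap1 kap2 (eta (r + c)) y p
      * pair_weight r kap2 kap1 c (x + y - p) p ks ms.
Proof.
move=> [k1 hk1] [k2 hk2].
elim: ks ms c x y => [|k ks IH] [|m ms] c x y /=;
  try by rewrite big1 // => i; rewrite mulr0.
  case: y => [|y].
    rewrite big_ord1 andbT addn0 subn0 /exchR /qbin subnn !qpoch0 !expr0.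
    by rewrite !mul1r !invr1 !mul1r andbT.
  rewrite andbF big1 // => -[[|p] /= hp] _; rewrite ?andbF ?mulr0 //.
  by rewrite addnS subn0 mulr0.
(* The total of the two labels leaving the column. *)
pose X := (m + x + y - k)%N.
transitivity (\sum_(y' < m.+1) (\sum_(p < m.+1)
     colW q kap1 (eta (r + c)) (rho c) (m + y - p) x k (m + y - p + x - k)
      * colW q kap2 (eta (r.+1 + c)) (rho c) m y (m + y - p) p
      * exchR q kap1 kap2 (eta (r.+1 + c)) p y')
    * pair_weight r kap2 kap1 c.+1 (X - y') y' ks ms).
  under [RHS]eq_bigr => y' _ do rewrite mulr_suml.
  rewrite exchange_big; apply: eq_bigr => -[p /= lt_pm] _.
  rewrite IH -addSnnS.
  set w := colW _ _ _ _ _ _ _ _; have [->|w0] := eqVneq w 0.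
    by rewrite !mul0r big1 // => i _; rewrite !mul0r.
  (* With this bound, the subtractions of k are not truncated. *)
  have le_k : (k <= m + y - p + x)%N.
    by apply: contraNT w0 => h; rewrite /w colW_eq0 //; lia.
  rewrite mulr_sumr [RHS](@sum_ord_trunc _ (fun j => w
    * colW q kap2 (eta (r.+1 + c)) (rho c) m y (m + y - p) p
    * exchR q kap1 kap2 (eta (r.+1 + c)) p j
    * pair_weight r kap2 kap1 c.+1 (X - j) j ks ms) p.+1) //; last first.
    by move=> j /andP[lt_j _]; rewrite /exchR leqNgt lt_j /= mulr0 mul0r.
  apply: eq_bigr => -[j /= lt_j] _; rewrite !mulrA.
  by congr (_ * pair_weight _ _ _ _ _ _ _ _); rewrite /X; lia.
transitivity (\sum_(y' < m.+1) (\sum_(p < y.+1) exchR q kap1 kap2 (eta (r + c)) y p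
     * (colW q kap2 (eta (r + c)) (rho c) (m + p - y') (x + y - p) k
          (m + p - y' + (x + y - p) - k)
        * colW q kap1 (eta (r.+1 + c)) (rho c) m p (m + p - y') y'))
    * pair_weight r kap2 kap1 c.+1 (X - y') y' ks ms).
  apply: eq_bigr => -[y' /= lt_y'] _; rewrite yang_baxter //.
under [LHS]eq_bigr => y' _ do rewrite mulr_suml.
rewrite exchange_big; apply: eq_bigr => -[p /= lt_py] _; rewrite mulr_sumr.
apply: eq_bigr => -[y' /= lt_ym] _; rewrite -!mulrA; do 3 congr (_ * _).
by congr pair_weight; rewrite /X; lia.
Qed.

Definition left_weight r kap x : F :=
  (kap * rho 0) ^+ x * (qpoch q (eta r / kap) x / qpoch q q x).

(** This is q-Saalschuetz with B = 0, that is q-Chu-Vandermonde, at A = eta r / kap1 and D = kap1 /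
    kap2, for which A D = eta r / kap2. *)
Lemma left_weight_exchange r kap1 kap2 X p : regular kap1 -> regular kap2 ->
  (p <= X)%N ->
  \sum_(y < X.+1) left_weight r kap1 (X - y) * left_weight r.+1 kap2 y
     * exchR q kap1 kap2 (eta r.+1) y p
  = left_weight r kap2 (X - p) * left_weight r.+1 kap1 p.
Proof.
move=> [k1 hk1] [k2 hk2] le_pX; have qq0 := qpochqq_neq0 q_nroot.
have [n ->] : exists n, X = (p + n)%N by exists (X - p)%N; rewrite subnKC.
rewrite addKn -addnS (@sum_ord_shift _ (fun y => left_weight r kap1 (p + n - y)
  * left_weight r.+1 kap2 y * exchR q kap1 kap2 (eta r.+1) y p)); last first.
  by move=> j lt_j; rewrite /exchR leqNgt lt_j mulr0.
have := q_saalschuetz q_nroot (eta r / kap1) 0 (kap1 / kap2) n.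
rewrite mulr0 !mul0r qpochx0 mulr1.
have -> : eta r / kap1 * (kap1 / kap2) = eta r / kap2 by field; rewrite k1 k2.
move=> h; rewrite /left_weight -h mulr_suml mulr_sumr mulr_suml.
pose f j := (kap1 * rho 0) ^+ (p + n - (p + j)) *
  (qpoch q (eta r / kap1) (p + n - (p + j)) / qpoch q q (p + n - (p + j))) *
  ((kap2 * rho 0) ^+ (p + j) *
   (qpoch q (eta r.+1 / kap2) (p + j) / qpoch q q (p + j)))
  * exchR q kap1 kap2 (eta r.+1) (p + j) p.
rewrite [LHS](_ : _ = \sum_(j < n.+1) f j) // -(big_mkord xpredT f) big_nat_rev /=.
rewrite big_mkord; apply: eq_bigr => -[j /=]; rewrite ltnS => le_jn _.
rewrite /f add0n subSS subnDl subKn // !mul0r !qpochx0 /exchR leq_addr addKn /qbin addKn.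
have -> : (kap2 * rho 0) ^+ n = (kap2 * rho 0) ^+ (n - j) * (kap2 * rho 0) ^+ j.
  by rewrite -exprD subnK.
have h1 := hk2 r.+1 (p + (n - j))%N.
have k2p : kap2 ^+ p != 0 by rewrite expf_neq0.
have k2j : kap2 ^+ j != 0 by rewrite expf_neq0.
rewrite !expr_div_n (exprD _ p) !exprMn; clear f h.
by field; rewrite !qq0 h1 k2p k2j.
Qed.

Variable B : nat.

Lemma sum_antidiagonal (f : nat -> nat -> F) X : (X <= B)%N ->
  (forall x y, (x + y)%N != X -> f x y = 0) ->
  \sum_(x < B.+1) \sum_(y < B.+1) f x y = \sum_(y < X.+1) f (X - y)%N y.
Proof.
move=> le_XB f0; rewrite exchange_big.
rewrite (@sum_ord_trunc _ (fun y => \sum_(x < B.+1) f x y) X.+1) //; last first.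
  by move=> y /andP[lt_y _]; rewrite big1 // => x _; rewrite f0 //; lia.
apply: eq_bigr => -[y /=]; rewrite ltnS => le_yX _.
have lt_x : (X - y < B.+1)%N by lia.
rewrite (bigD1 (Ordinal lt_x)) //= big1 ?addr0 // => -[x /= hx] ne.
by rewrite f0 //; apply: contraNN ne => /eqP e; apply/eqP/val_inj => /=; lia.
Qed.

Definition pair_sum r kap1 kap2 ks ms := \sum_(x < B.+1) \sum_(y < B.+1)
  left_weight r kap1 x * left_weight r.+1 kap2 y
  * pair_weight r kap1 kap2 1 x y ks ms.

(** Conservation fixes x + y = X. The R-matrix that [pair_weight_exchange] brings to column 1 is
    then absorbed by the left boundary through [left_weight_exchange]. *)
Lemma pair_sumC r kap1 kap2 ks ms : regular kap1 -> regular kap2 ->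
  (sumn ks <= B)%N -> pair_sum r kap1 kap2 ks ms = pair_sum r kap2 kap1 ks ms.
Proof.
move=> k1 k2 le_B; have [lt_s|le_s] := ltnP (sumn ks) (sumn ms).
  have z kap kap' x y : pair_weight r kap kap' 1 x y ks ms = 0.
    by apply/eqP; apply: contraTT lt_s => /pair_weight_conserve; lia.
  by rewrite /pair_sum !big1 // => x _; rewrite big1 // => y _; rewrite z mulr0.
pose X := (sumn ks - sumn ms)%N.
have le_X : (X <= B)%N by rewrite /X; lia.
have z kap kap' x y : (x + y)%N != X -> pair_weight r kap kap' 1 x y ks ms = 0.
  move=> ne; apply/eqP; apply: contraNT ne => /pair_weight_conserve e.
  by apply/eqP; rewrite /X; lia.
have psE kap kap' : pair_sum r kap kap' ks ms = \sum_(y < X.+1)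
    left_weight r kap (X - y) * left_weight r.+1 kap' y
    * pair_weight r kap kap' 1 (X - y) y ks ms.
  rewrite /pair_sum (@sum_antidiagonal (fun x y => left_weight r kap x
    * left_weight r.+1 kap' y * pair_weight r kap kap' 1 x y ks ms) X) //.
  by move=> x y /z->; rewrite mulr0.
rewrite !psE.
transitivity (\sum_(p < X.+1) (\sum_(y < X.+1) left_weight r kap1 (X - y)
    * left_weight r.+1 kap2 y * exchR q kap1 kap2 (eta r.+1) y p)
    * pair_weight r kap2 kap1 1 (X - p) p ks ms).
  under [RHS]eq_bigr => p _ do rewrite mulr_suml.
  rewrite exchange_big; apply: eq_bigr => -[y /=]; rewrite ltnS => le_y _.
  rewrite pair_weight_exchange // addn1 mulr_sumr subnK //.
  rewrite [RHS](@sum_ord_trunc _ (fun p => left_weight r kap1 (X - y)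
    * left_weight r.+1 kap2 y * exchR q kap1 kap2 (eta r.+1) y p
    * pair_weight r kap2 kap1 1 (X - p) p ks ms) y.+1) //; last first.
    by move=> j /andP[lt_j _]; rewrite /exchR leqNgt lt_j /= mulr0 mul0r.
  by apply: eq_bigr => p _; rewrite !mulrA.
by apply: eq_bigr => -[p /= lt_p] _; rewrite left_weight_exchange.
Qed.

(** Conservation bounds the labels between the rows by the sum of [ks], so the cutoff B loses
    nothing. The label in a column is b = m + y - p. *)
Lemma sum_row_weights r kap1 kap2 c x y L ks ms : size ks = L -> (sumn ks <= B)%N ->
  \sum_(V : 'rV['I_B.+1]_L)
     row_weight r kap1 c x ks (rseq V) * row_weight r.+1 kap2 c y (rseq V) ms
  = pair_weight r kap1 kap2 c x y ks ms.
Proof.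
move=> <-; elim: ks ms c x y => [|k ks IH] ms c x y /= le_B.
  rewrite (sum_rV0 _ (const_mx ord0)) rseq0 /=.
  by case: ms => [|m ms]; rewrite ?mulr0 //= -natrM mulnb.
rewrite sum_rV_cons; under eq_bigr do under eq_bigr do rewrite rseq_cons /=.
case: ms => [|m ms].
  by rewrite big1 // => b _; rewrite big1 // => V _; rewrite mulr0.
pose f b := colW q kap1 (eta (r + c)) (rho c) b x k (b + x - k)
   * colW q kap2 (eta (r.+1 + c)) (rho c) m y b (m + y - b)
   * pair_weight r kap1 kap2 c.+1 (b + x - k) (m + y - b) ks ms.
transitivity (\sum_(b < B.+1) f b).
  apply: eq_bigr => b _; rewrite /f -IH ?mulr_sumr; last by lia.
  by apply: eq_bigr => V _; rewrite mulrACA.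
(* A label above m + y breaks conservation in the lower row; one above B would exceed
   [k + sumn ks]. *)
have f0 b : (m + y < b)%N || (B < b)%N -> f b = 0.
  move=> h; rewrite /f.
  set w := colW _ _ _ _ b x k _; have [->|w0] := eqVneq w 0; first by rewrite !mul0r.
  set w2 := colW _ _ _ _ m y b _; have [->|w20] := eqVneq w2 0.
    by rewrite mulr0 mul0r.
  have [->|nz] := eqVneq (pair_weight r kap1 kap2 c.+1 (b + x - k) (m + y - b) ks ms) 0.
    by rewrite mulr0.
  have e := pair_weight_conserve nz.
  have /andP[/eqP e1 e1'] : ((b + x == k + (b + x - k)) && (b + x - k <= b))%N.
    by apply: contraNT w0 => /colW_eq0 h0; rewrite /w h0.
  have /andP[/eqP e2 _] : ((m + y == b + (m + y - b)) && (m + y - b <= m))%N.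
    by apply: contraNT w20 => /colW_eq0 h0; rewrite /w2 h0.
  move: h; lia.
(* Both ranges are compared with the larger of the two; [f0] removes the excess. *)
transitivity (\sum_(b < (m + y).+1) f b).
  rewrite -(@sum_ord_trunc _ f (m + y).+1 (maxn B (m + y)).+1); last 2 first.
  - by rewrite ltnS leq_maxr.
  - by move=> j /andP[lt_j _]; rewrite f0 // lt_j.
  symmetry; apply: sum_ord_trunc; first by rewrite ltnS leq_maxl.
  by move=> j /andP[lt_j _]; rewrite f0 // lt_j orbT.
rewrite -(big_mkord xpredT f) big_nat_rev /= big_mkord.
rewrite (@sum_ord_trunc _ (fun p => f (0 + (m + y).+1 - p.+1)%N) m.+1); last 2 first.
- by rewrite ltnS leq_addr.
- move=> p /andP[lt_p lt_p'].
  by rewrite /f [X in _ * X * _]colW_eq0 ?mulr0 ?mul0r //; lia.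
apply: eq_bigr => -[p /=]; rewrite ltnS => le_pm _.
by rewrite /f add0n subSS; have -> : (m + y - (m + y - p) = p)%N by lia.
Qed.

Definition row_sum r kap ks ms :=
  \sum_(x < B.+1) left_weight r kap x * row_weight r kap 1 x ks ms.

Lemma row_sum_conserve r kap ks ms :
  row_sum r kap ks ms != 0 -> (sumn ms <= sumn ks)%N.
Proof.
move=> nz; rewrite leqNgt; apply: contraNN nz => lt_s; apply/eqP.
rewrite /row_sum big1 // => x _.
have [->|h] := eqVneq (row_weight r kap 1 x ks ms) 0; first by rewrite mulr0.
by have := row_weight_conserve h; lia.
Qed.

Lemma row_sumC r kap1 kap2 ks ms L : regular kap1 -> regular kap2 ->
  size ks = L -> (sumn ks <= B)%N ->
  \sum_(V : 'rV['I_B.+1]_L)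
    row_sum r kap1 ks (rseq V) * row_sum r.+1 kap2 (rseq V) ms
  = \sum_(V : 'rV['I_B.+1]_L)
    row_sum r kap2 ks (rseq V) * row_sum r.+1 kap1 (rseq V) ms.
Proof.
move=> k1 k2 sz le_B.
suff E kap kap' : \sum_(V : 'rV['I_B.+1]_L)
    row_sum r kap ks (rseq V) * row_sum r.+1 kap' (rseq V) ms
    = pair_sum r kap kap' ks ms by rewrite !E pair_sumC.
rewrite /row_sum; under eq_bigr => V _ do rewrite big_distrlr /=.
rewrite exchange_big; apply: eq_bigr => x _.
rewrite exchange_big; apply: eq_bigr => y _.
rewrite -(sum_row_weights _ _ _ _ _ _ _ sz) // mulr_sumr.
by apply: eq_bigr => V _; rewrite mulrACA.
Qed.

Variable L : nat.

(** The row parameters form a list, so that symmetry becomes invariance under [perm_eq]. The base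
    case imposes the bottom boundary. *)
Fixpoint chain_sum r (kaps : seq F) (ks ms : seq nat) {struct kaps} : F :=
  if kaps is kap :: kaps' then \sum_(V : 'rV['I_B.+1]_L)
    row_sum r kap ks (rseq V) * chain_sum r.+1 kaps' (rseq V) ms
  else (ks == ms)%:R.

(** Where [row_sum] is nonzero the label total does not grow downwards, so the bound B passes to the
    next row. *)
Lemma chain_sum_cons r kap s1 s2 ks ms :
  (forall r ks, size ks = L -> (sumn ks <= B)%N ->
     chain_sum r s1 ks ms = chain_sum r s2 ks ms) ->
  size ks = L -> (sumn ks <= B)%N ->
  chain_sum r (kap :: s1) ks ms = chain_sum r (kap :: s2) ks ms.
Proof.
move=> IH sz le_B /=; apply: eq_bigr => V _.
have [->|/row_sum_conserve le_s] := eqVneq (row_sum r kap ks (rseq V)) 0.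
  by rewrite !mul0r.
by rewrite IH ?size_rseq // (leq_trans le_s).
Qed.

Lemma chain_sum_swap r kap1 kap2 s ks ms : regular kap1 -> regular kap2 ->
  size ks = L -> (sumn ks <= B)%N ->
  chain_sum r (kap1 :: kap2 :: s) ks ms = chain_sum r (kap2 :: kap1 :: s) ks ms.
Proof.
move=> k1 k2 sz le_B /=.
do 2 (under eq_bigr => V _ do rewrite mulr_sumr; symmetry).
rewrite exchange_big [RHS]exchange_big; apply: eq_bigr => V _ /=.
under eq_bigr => W _ do rewrite mulrA; rewrite -mulr_suml.
under [RHS]eq_bigr => W _ do rewrite mulrA; rewrite -mulr_suml.
by rewrite (row_sumC _ _ k1 k2 sz).
Qed.

(** With s2 split at the head of s1, the tails agree by induction, and the head then moves past [sa]
    by adjacent swaps. *)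
Lemma chain_sum_perm r s1 s2 ks ms : (forall kap, kap \in s1 -> regular kap) ->
  perm_eq s1 s2 -> size ks = L -> (sumn ks <= B)%N ->
  chain_sum r s1 ks ms = chain_sum r s2 ks ms.
Proof.
elim: s1 s2 r ks => [|kap s1 IH] s2 r ks reg12 p12.
  by move: p12; rewrite perm_sym => /perm_nilP->.
have kap_s2 : kap \in s2 by rewrite -(perm_mem p12) mem_head.
have reg2 kap' : kap' \in s2 -> regular kap'.
  by rewrite -(perm_mem p12); apply: reg12.
case/splitPr: kap_s2 p12 reg2 => [sa sb] p12 reg2 sz le_B.
transitivity (chain_sum r (kap :: sa ++ sb) ks ms).
  apply: chain_sum_cons => // r' ks' sz' le_B'; apply: IH => //.
    by move=> kap' h; apply: reg12; rewrite inE h orbT.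
  by rewrite -(perm_cons kap) (perm_trans p12) // -cat1s perm_catCA.
have kap_reg : regular kap by apply: reg12; rewrite mem_head.
elim: sa r ks sz le_B {p12} reg2 => // kap' sa IHsa r ks sz le_B reg2.
rewrite !cat_cons chain_sum_swap //; last by apply: reg2; rewrite mem_head.
apply: chain_sum_cons => // r' ks' sz' le_B'; apply: IHsa => // k h.
by apply: reg2; rewrite inE h orbT.
Qed.

End Chains.

(** * Chains of rows as sums over matrices *)

Section ChainMatrices.
Variables (F : fieldType) (q : F) (eta rho : nat -> F) (B : nat).
Local Notation rV L := 'rV['I_B.+1]_L.

Lemma widen_lift0 n (i : 'I_n) :
  widen_ord (leqnSn n.+1) (lift ord0 i) = lift ord0 (widen_ord (leqnSn n) i).
Proof. exact: val_inj. Qed.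

Lemma widen_ord0 n : widen_ord (leqnSn n.+1) ord0 = ord0.
Proof. exact: val_inj. Qed.

Lemma lift0_max n : lift ord0 (@ord_max n) = ord_max.
Proof. exact: val_inj. Qed.

Lemma row_mx_ord0 (T : Type) n (a : T) (V : 'rV_n) :
  row_mx (const_mx a : 'M_1) V 0 (ord0 : 'I_n.+1) = a.
Proof.
by rewrite (_ : ord0 = lshift n ord0 :> 'I_(1 + n)) ?row_mxEl ?mxE; last exact: val_inj.
Qed.

Lemma row_mx_lift0 (T : Type) n (a : T) (V : 'rV_n) (i : 'I_n) :
  row_mx (const_mx a : 'M_1) V 0 (lift ord0 i : 'I_n.+1) = V 0 i.
Proof.
by rewrite (_ : lift ord0 i = rshift 1 i :> 'I_(1 + n)) ?row_mxEr //; apply: val_inj.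
Qed.

Lemma row_col_mx_ord0 (T : Type) n p (V : 'rV[T]_p) (A : 'M_(n, p)) :
  row (ord0 : 'I_n.+1) (col_mx V A) = V.
Proof.
apply/rowP => j; rewrite mxE.
have -> : (ord0 : 'I_n.+1) = lshift n (ord0 : 'I_1) by apply: val_inj.
by rewrite [LHS](col_mxEu V A) ord1.
Qed.

Lemma row_col_mx_lift0 (T : Type) n p (V : 'rV[T]_p) (A : 'M_(n, p)) (i : 'I_n) :
  row (lift ord0 i : 'I_n.+1) (col_mx V A) = row i A.
Proof.
apply/rowP => j; rewrite mxE [RHS]mxE.
have -> : (lift ord0 i : 'I_n.+1) = rshift 1 i by apply: val_inj.
by rewrite [LHS](col_mxEd V A).
Qed.

Lemma rseqS L (V : rV L.+1) :
  rseq V = val (V 0 ord0) :: rseq (\row_i V 0 (lift ord0 i)).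
Proof.
rewrite /rseq enum_ordSl /= -map_comp; congr (_ :: _).
by apply: eq_map => i /=; rewrite mxE.
Qed.

Definition edge_weight L r kap c (V W : rV L) (u : rV L.+1) : F :=
  (\prod_(i < L) colW q kap (eta (r + (c + i))) (rho (c + i))
     (W 0 i) (u 0 (widen_ord (leqnSn L) i)) (V 0 i) (u 0 (lift ord0 i)))
  * (u 0 ord_max == 0%N :> nat)%:R.

(** Conservation determines the horizontal labels from left to right, so at most one u
    contributes. *)
Lemma row_weight_mx L r kap c (x : 'I_B.+1) (V W : rV L) :
  row_weight q eta rho r kap c x (rseq V) (rseq W)
  = \sum_(u : rV L) edge_weight r kap c V W (row_mx (const_mx x : 'M_1) u).
Proof.
elim: L c x V W => [|L IH] c x V W.
  rewrite (sum_rV0 _ (const_mx ord0)) !rseq0 /edge_weight big_ord0 mul1r.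
  by rewrite (_ : ord_max = ord0) ?row_mx_ord0 //; apply: val_inj.
rewrite !rseqS /=; set k := V 0 ord0; set m := W 0 ord0.
set V' := \row_i V _ _; set W' := \row_i W _ _.
rewrite sum_rV_cons.
transitivity (\sum_(p < B.+1) colW q kap (eta (r + c)) (rho c) m x k p
   * row_weight q eta rho r kap c.+1 p (rseq V') (rseq W')).
  (* If the forced label exceeds B, it exceeds m as well, and the weight is zero. *)
  have [le_p|lt_p] := ltnP (m + x - k) B.+1.
    rewrite (bigD1 (Ordinal le_p)) //= [X in _ + X]big1 ?addr0 // => p ne.
    rewrite colW_eq0 ?mul0r //; apply: contraNN ne => /andP[/eqP e _].
    by apply/eqP/val_inj => /=; rewrite e addKn.
  rewrite colW_eq0 ?mul0r; last by have := ltn_ord m; lia.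
  by rewrite big1 // => p _; rewrite colW_eq0 ?mul0r //; have := ltn_ord p; lia.
apply: eq_bigr => p _; rewrite IH mulr_sumr; apply: eq_bigr => u _.
rewrite /edge_weight big_ord_recl widen_ord0 row_mx_ord0 !row_mx_lift0 addn0.
rewrite row_mx_ord0 -mulrA; congr (_ * (_ * _)); last first.
  by rewrite -lift0_max row_mx_lift0.
apply: eq_bigr => i _; rewrite [W' 0 i]mxE [V' 0 i]mxE widen_lift0 !row_mx_lift0 /=.
by rewrite /bump /= add1n addnS addSn.
Qed.

Definition row_mx_weight L r kap (V W : rV L) (u : rV L.+1) : F :=
  left_weight q eta rho r kap (u 0 ord0) * edge_weight r kap 1 V W u.

Lemma row_sum_mx L r kap (V W : rV L) :
  row_sum q eta rho B r kap (rseq V) (rseq W) = \sum_u row_mx_weight r kap V W u.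
Proof.
rewrite sum_rV_cons; apply: eq_bigr => x _.
rewrite row_weight_mx mulr_sumr; apply: eq_bigr => u _.
by rewrite /row_mx_weight row_mx_ord0.
Qed.

(** Only the rows below V are summed over; [col_mx] puts the fixed top row back. *)
Lemma chain_sum_mx L n (kap : 'I_n -> F) r (V : rV L) ms :
  chain_sum q eta rho B L r [seq kap i | i <- enum 'I_n] (rseq V) ms
  = \sum_(v : 'M['I_B.+1]_(n, L)) \sum_(h : 'M['I_B.+1]_(n, L.+1))
      (rseq (row ord_max (col_mx V v : 'M_(n.+1, L))) == ms)%:R
      * \prod_(i < n) row_mx_weight (r + i) (kap i)
          (row (widen_ord (leqnSn n) i) (col_mx V v : 'M_(n.+1, L)))
          (row (lift ord0 i) (col_mx V v : 'M_(n.+1, L))) (row i h).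
Proof.
elim: n kap r V => [|n IH] kap r V.
  have -> : enum 'I_0 = [::] by apply/nilP; rewrite /nilp size_enum_ord.
  rewrite (sum_flatmx _ 0) (sum_flatmx _ 0).
  rewrite big_ord0 mulr1 (_ : ord_max = ord0) ?row_col_mx_ord0 //; exact: val_inj.
rewrite enum_ordSl /= -map_comp (@sum_col_mx _ _ 1 n L); apply: eq_bigr => W _.
rewrite IH row_sum_mx mulr_sumr; apply: eq_bigr => v _.
rewrite (@sum_col_mx _ _ 1 n L.+1) mulr_suml; apply: eq_bigr => u _.
rewrite mulr_sumr; apply: eq_bigr => h _.
rewrite -lift0_max row_col_mx_lift0 mulrCA; congr (_ * _).
rewrite big_ord_recl widen_ord0 !row_col_mx_ord0 !row_col_mx_lift0 addn0.
rewrite row_col_mx_ord0; congr (_ * _).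
apply: eq_bigr => i _; rewrite !widen_lift0 !row_col_mx_lift0 /=.
by rewrite /bump /= add1n addnS.
Qed.

End ChainMatrices.

(** * The partition function as a chain of rows *)

Definition columns L la := mkseq (fun c => mult (conj_part la) c.+1) L.

Lemma columnsE L la : is_part la ->
  columns L la = mkseq (fun c => part la c.+1 - part la c.+2)%N L.
Proof. by move=> la_p; apply: eq_mkseq => c; rewrite mult_conj_part. Qed.

Lemma sumn_columns L la : is_part la -> (size la <= L)%N ->
  sumn (columns L la) = part la 1.
Proof.
move=> la_p le_L; rewrite columnsE // sumnE big_map -(subn0 L) big_mkord.
suff : (\sum_(c < L) (part la c.+1 - part la c.+2) + part la L.+1 = part la 1)%N.
  by rewrite [part la L.+1]nth_default ?addn0.
elim: L {le_L} => [|L IH]; first by rewrite big_ord0.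
by rewrite big_ord_recr /= -addnA subnK // part_nonincr.
Qed.

Lemma rseq_inj B L : injective (@rseq B L).
Proof.
move=> V W /eq_in_map VW; apply/rowP => i; apply: val_inj.
by apply: VW; rewrite mem_enum.
Qed.

Lemma rseq_mkseqP B L (V : 'rV['I_B.+1]_L) (f : nat -> nat) :
  reflect (forall c : 'I_L, V 0 c = f c :> nat) (rseq V == mkseq f L).
Proof.
apply: (iffP eqP) => [|Vf].
  rewrite /rseq /mkseq -val_enum_ord -map_comp => /eq_in_map h c.
  by rewrite [LHS]h // mem_enum.
by rewrite /rseq /mkseq -val_enum_ord -map_comp; exact: eq_map.
Qed.

Lemma sumn_rseq B L (V : 'rV['I_B.+1]_L) : sumn (rseq V) = (\sum_(c < L) V 0%R c)%N.
Proof. by rewrite sumnE big_map big_enum. Qed.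

Section PartitionFunction.
Variables (F : fieldType) (q : F) (rxi rs : nat -> F).
Hypothesis rxi_neq0 : forall i, rxi i != 0.

(** The shift accounts for rows counted from 0. Columns count from 1, which leaves [rho 0] and
    [eta r] for the left boundary. *)
Let eta j := xi rxi j.+1 * spar rs j.+1.
Let rho c := spar rs c / xi rxi c.

(** The square of s_c^(r) splits as xi_(r+c) s_(r+c) times s_c / xi_c. *)
Lemma vertexW_colW kap r c i j k l :
  vertexW q (xi rxi (r.+1 + c.+1) * spar rs (r.+1 + c.+1) / kap)
    (spar_shift rxi rs r.+1 c.+1 ^+ 2) i j k l
  = colW q kap (eta (r + (1 + c))) (rho (1 + c)) i j k l.
Proof.
rewrite /colW /spar_shift (addnC c.+1); congr vertexW.
by rewrite /eta /rho /xi /spar /= !exprMn exprVn; ring.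
Qed.

Section Sums.
Variables (n L : nat) (kappa : 'I_n -> F) (la mu : seq nat).
Hypotheses (la_p : is_part la) (mu_p : is_part mu).
Hypotheses (la_L : (size la < L)%N) (mu_L : (size mu < L)%N).
Let B := part la 1.

(** The boundary conditions identify a with the first column of h, which collapses the sum over a.
    The constraint on the sum of a follows from conservation wherever the weight is nonzero. *)
Lemma Fs_chain_sum :
  Fs q rxi rs L kappa la mu
  = chain_sum q eta rho B L 0 [seq kappa i | i <- enum 'I_n]
      (columns L la) (columns L mu).
Proof.
have sum_la : sumn (columns L la) = B by rewrite sumn_columns // ltnW.
have sum_mu : sumn (columns L mu) = part mu 1 by rewrite sumn_columns // ltnW.
have [V0 V0E] : exists V0 : 'rV['I_B.+1]_L, rseq V0 = columns L la.
  exists (\row_c inord (mult (conj_part la) c.+1)); apply/eqP/rseq_mkseqP => c.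
  rewrite mxE inordK // ltnS mult_conj_part // (leq_trans (leq_subr _ _)) //.
  rewrite /B; elim: (nat_of_ord c) => // k; apply: leq_trans.
  exact: part_nonincr.
pose term (v : 'M['I_B.+1]_(n.+1, L)) (h : 'M['I_B.+1]_(n, L.+1)) :=
  (rseq (row ord_max v) == columns L mu)%:R
  * \prod_(i < n) row_mx_weight q eta rho (0 + i) (kappa i)
      (row (widen_ord (leqnSn n) i) v) (row (lift ord0 i) v) (row i h).
(* The top row joins the summation, pinned by an indicator, to match the shape of [ZW]. *)
transitivity (\sum_(v : 'M['I_B.+1]_(n.+1, L)) \sum_(h : 'M['I_B.+1]_(n, L.+1))
    (rseq (row ord0 v) == columns L la)%:R * term v h); last first.
  rewrite -V0E chain_sum_mx (@sum_col_mx _ _ 1 n L) (bigD1 V0) //=.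
  rewrite [X in _ + X]big1 ?addr0; last first.
    move=> V ne; rewrite big1 // => v _; rewrite big1 // => h _.
    by rewrite row_col_mx_ord0 (inj_eq (@rseq_inj _ _)) (negbTE ne) mul0r.
  apply: eq_bigr => v _; apply: eq_bigr => h _.
  by rewrite row_col_mx_ord0 eqxx mul1r.
rewrite /Fs /ZW big_mkcond /=.
pose P (a : {ffun 'I_n -> 'I_B.+1}) : F := \prod_(r < n)
       ((kappa r * spar rs 0 / xi rxi 0) ^+ a r
        * (qpoch q ((kappa r)^-1 * spar rs r.+1 * xi rxi r.+1) (a r)
           / qpoch q q (a r))).
pose C (a : {ffun 'I_n -> 'I_B.+1}) := (\sum_(r < n) a r + part mu 1 == B)%N.
pose bd (v : 'M['I_B.+1]_(n.+1, L)) (h : 'M['I_B.+1]_(n, L.+1)) a :=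
  zw_boundary la mu a (fun r c => v r c) (fun r c => h r c).
pose w (v : 'M['I_B.+1]_(n.+1, L)) (h : 'M['I_B.+1]_(n, L.+1)) :=
  zw_weight q rxi rs kappa (fun r c => v r c) (fun r c => h r c).
transitivity (\sum_v \sum_h \sum_a
   (if C a && bd v h (fun r => a r) then P a * w v h else 0)).
  rewrite (eq_bigr (fun a => \sum_v \sum_h
     (if C a && bd v h (fun r => a r) then P a * w v h else 0))).
    rewrite exchange_big; apply: eq_bigr => v _; exact: exchange_big.
  move=> a _; rewrite /C; case: ifP => _; last by rewrite big1 // => v _; rewrite big1.
  rewrite mulr_sumr; apply: eq_bigr => v _; rewrite mulr_sumr big_mkcond.
  by apply: eq_bigr => h _ /=.
apply: eq_bigr => v _; apply: eq_bigr => h _.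
pose a0 : {ffun 'I_n -> 'I_B.+1} := [ffun r => h r ord0].
pose bd0 := [&& rseq (row ord0 v) == columns L la, rseq (row ord_max v) == columns L mu
  & [forall r : 'I_n, h r ord_max == 0%N :> nat]].
have bdE (a : {ffun 'I_n -> 'I_B.+1}) : bd v h (fun r => a r) = bd0 && (a == a0).
  have colE i nu : [forall c : 'I_L, v i c == mult (conj_part nu) c.+1 :> nat]
      = (rseq (row i v) == columns L nu).
    apply/idP/idP => [/forallP e|/(rseq_mkseqP _ (fun c => mult (conj_part nu) c.+1)) e].
      by apply/rseq_mkseqP => c; rewrite mxE; apply/eqP.
    by apply/forallP => c; rewrite -e mxE.
  have aE : [forall r, h r ord0 == a r :> nat] = (a == a0).
    apply/forallP/eqP => [e|-> r]; last by rewrite ffunE.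
    by apply/ffunP => r; rewrite ffunE; apply: val_inj => /=; rewrite (eqP (e r)).
  by rewrite /bd /zw_boundary /bd0 !colE aE -!andbA; do 2 congr (_ && _); rewrite andbC.
rewrite (bigD1 a0) //= [X in _ + X]big1 ?addr0; last first.
  by move=> a /negbTE ne; rewrite bdE ne !andbF.
rewrite bdE eqxx andbT /term.
have -> : \prod_(i < n) row_mx_weight q eta rho (0 + i) (kappa i)
      (row (widen_ord (leqnSn n) i) v) (row (lift ord0 i) v) (row i h)
   = P a0 * w v h * [forall r : 'I_n, h r ord_max == 0%N :> nat]%:R.
  rewrite /P /w /zw_weight.
  have -> : ([forall r : 'I_n, h r ord_max == 0%N :> nat])%:R
     = \prod_(r < n) (h r ord_max == 0%N :> nat)%:R :> F.
    case: forallP => [e|ne].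
      by rewrite big1 // => r _; rewrite e.
    have [r ner] : exists r, ~~ (h r ord_max == 0%N :> nat).
      apply/existsP; rewrite -negb_forall; apply/forallP.
      exact: ne.
    by rewrite (bigD1 r) //= (negbTE ner) mul0r.
  rewrite -!big_split; apply: eq_bigr => r _ /=.
  rewrite /row_mx_weight /edge_weight !mxE ffunE mulrA; congr (_ * _ * _).
    rewrite /left_weight add0n; congr (_ ^+ _ * (qpoch _ _ _ / _)).
      by rewrite /rho mulrA.
    by rewrite /eta mulrC (mulrC (xi _ _)) mulrA.
  by apply: eq_bigr => c _; rewrite !mxE vertexW_colW.
rewrite /bd0; have [laE|_] := eqVneq (rseq (row ord0 v)) (columns L la); last first.
  by rewrite /= andbF mul0r.
have [muE|_] := eqVneq (rseq (row ord_max v)) (columns L mu); last first.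
  by rewrite /= andbF mul0r mulr0.
rewrite /= !mul1r; case: forallP => [hmax|_]; last by rewrite andbF mulr0.
rewrite andbT mulr1; case: ifP => // /negbT.
(* What remains is the constraint [C a0] for a nonzero weight: conservation is summed along each
   row, then over the rows. *)
have [->|w0 /negP[]] := eqVneq (w v h) 0; first by rewrite mulr0.
have conserve (r : 'I_n) (c : 'I_L) : (v (lift ord0 r) c + h r (widen_ord (leqnSn L) c)
    = v (widen_ord (leqnSn n) r) c + h r (lift ord0 c))%N.
  move: w0; rewrite /w /zw_weight => /prodf_neq0/(_ r isT)/prodf_neq0/(_ c isT).
  by rewrite /vertexW; case: ifP => [/andP[/eqP]|_] //; rewrite eqxx.
have row_eq (r : 'I_n) : (\sum_(c < L) v (lift ord0 r) c + h r ord0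
    = \sum_(c < L) v (widen_ord (leqnSn n) r) c)%N.
  have hsum : (h r ord0 + \sum_(c < L) h r (lift ord0 c)
      = \sum_(c < L) h r (widen_ord (leqnSn L) c))%N.
    rewrite -(big_ord_recl L (fun c => nat_of_ord (h r c))) big_ord_recr /=.
    by rewrite (eqP (hmax r)) addn0.
  apply/eqP; rewrite -(eqn_add2r (\sum_(c < L) h r (lift ord0 c))) -addnA hsum.
  by rewrite -!big_split /=; apply/eqP/eq_bigr => c _; rewrite conserve.
have sumE i nu : rseq (row i v) = columns L nu ->
    (\sum_(c < L) v i c = sumn (columns L nu))%N.
  by move=> <-; rewrite sumn_rseq; apply: eq_bigr => c _; rewrite mxE.
have := sumE _ _ laE; have := sumE _ _ muE; rewrite sum_mu sum_la.
have : (\sum_(r < n) h r ord0 + \sum_(r < n) \sum_(c < L) v (lift ord0 r) c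
   = \sum_(r < n) \sum_(c < L) v (widen_ord (leqnSn n) r) c)%N.
  by rewrite -big_split; apply: eq_bigr => r _ /=; rewrite -row_eq addnC.
have := @big_ord_recl nat 0%N addn n (fun i => (\sum_(c < L) v i c)%N).
rewrite big_ord_recr /=.
have a0E : (\sum_(r < n) a0 r = \sum_(r < n) h r ord0)%N.
  by apply: eq_bigr => r _; rewrite ffunE.
rewrite /C a0E.
move=> e1 e2 <- e4; apply/eqP; rewrite -[RHS]e4.
apply: (@addIn (\sum_(r < n) \sum_(c < L) v (lift ord0 r) c)%N).
by rewrite addnAC e2 e1.
Qed.

End Sums.
End PartitionFunction.

(** * Symmetry and polynomiality *)

(** Permuting kappa permutes the list of row parameters, so [chain_sum_perm] applies; the
    inequations on kappa give [regular]. *)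
Lemma Fs_perm (F : fieldType) (q : F) (rxi rs : nat -> F) n L
    (kappa : 'I_n -> F) (s : 'S_n) (la mu : seq nat) :
  generic q rxi rs -> (forall r, kappa r != 0) ->
  (forall r c i, xi rxi c * spar rs c * q ^+ i != kappa r) ->
  is_part la -> is_part mu -> (size la < L)%N -> (size mu < L)%N ->
  Fs q rxi rs L (kappa \o s) la mu = Fs q rxi rs L kappa la mu.
Proof.
move=> [q0 q_nroot rxi0 rs0 gen] k0 k_eta la_p mu_p la_L mu_L.
rewrite !Fs_chain_sum //; apply: chain_sum_perm => //.
- by move=> c; rewrite mulf_neq0 // expf_neq0.
- by move=> c; rewrite mulf_neq0 ?invr_eq0 // expf_neq0.
- move=> r c i; apply: qpoch_neq0 => j; apply: contraNneq (gen c r.+1 j) => e.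
  rewrite -[X in _ == X]e; apply/eqP; congr (_ * _).
  rewrite /spar_shift addnS (addnC c) /xi /spar.
  by field.
- move=> _ /mapP[r _ ->]; split=> [|c i]; first exact: k0.
  apply: qpoch_neq0 => j; apply: contraNneq (k_eta (s r) c.+1 j) => e.
  rewrite -[X in _ == X](mul1r (kappa (s r))) -e; apply/eqP.
by rewrite /=; field; exact: k0.
- rewrite (map_comp kappa s); apply: (perm_map kappa).
  apply: uniq_perm; rewrite ?enum_uniq //.
    by rewrite map_inj_uniq ?enum_uniq //; apply: perm_inj.
  move=> r; rewrite mem_enum; apply/mapP.
  by exists (s^-1%g r); rewrite ?mem_enum ?permKV.
- by rewrite size_mkseq.
- by rewrite sumn_columns // ltnW.
Qed.

(** * Polynomiality in the row parameters *)

Lemma expr_mul_qpochV (F : fieldType) (q a b x : F) l : x != 0 ->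
  (x * b) ^+ l * qpoch q (a / x) l = \prod_(i < l) ((x + (0 - a * q ^+ i)) * b).
Proof.
move=> x0; rewrite /qpoch -{1}(card_ord l) -prodr_const -big_split /=.
by apply: eq_bigr => i _; field.
Qed.

(** Groups the power of x with the symbol whose denominators it clears, and collects the factors
    free of x at the end. *)
Lemma vertexW_ratio (F : fieldType) (q e s2 x : F) i j k l :
  x != 0 -> e != 0 -> (i + j = k + l)%N -> (l <= i)%N ->
  vertexW q (e / x) s2 i j k l =
  ((x * (s2 / e)) ^+ l * qpoch q (e / x) l) * qpoch q (x * (s2 / e)) (i - l)
  * ((qpoch q s2 i)^-1 * (qpoch q q i / (qpoch q q (i - l) * qpoch q q l))).
Proof.
move=> x0 e0 ijkl le_li; rewrite /vertexW ijkl eqxx le_li /=.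
have -> : s2 / (e / x) = x * (s2 / e) by field; rewrite e0 x0.
rewrite !mulrA; congr (_ / _).
by rewrite -!mulrA; congr (_ * _); rewrite mulrCA; congr (_ * _); rewrite !mulrA.
Qed.

Section PolynomialFamilies.
Variables (K : fieldType) (n : nat).
Local Notation frac := {fraction {mpoly K[n]}}.

Definition is_const (z : frac) := exists c : K, z = const_frac n c.

Lemma const_fracE (c : K) : const_frac n c = (@FracField.tofrac _ \o @mpolyC n K) c.
Proof. by []. Qed.

Lemma is_const_const c : is_const (const_frac n c).
Proof. by exists c. Qed.

Lemma is_const1 : is_const 1.
Proof. by exists 1; rewrite const_fracE rmorph1. Qed.

Lemma is_constM z1 z2 : is_const z1 -> is_const z2 -> is_const (z1 * z2).
Proof. by move=> [c1 ->] [c2 ->]; exists (c1 * c2); rewrite !const_fracE rmorphM. Qed.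

Lemma is_constB z1 z2 : is_const z1 -> is_const z2 -> is_const (z1 - z2).
Proof. by move=> [c1 ->] [c2 ->]; exists (c1 - c2); rewrite !const_fracE rmorphB. Qed.

Lemma is_constV z : is_const z -> is_const z^-1.
Proof. by move=> [c ->]; exists c^-1; rewrite !const_fracE fmorphV. Qed.

Lemma is_constX z k : is_const z -> is_const (z ^+ k).
Proof. by move=> [c ->]; exists (c ^+ k); rewrite !const_fracE rmorphXn. Qed.

Lemma is_const_prod I (r : seq I) (f : I -> frac) :
  (forall i, is_const (f i)) -> is_const (\prod_(i <- r) f i).
Proof. by move=> cf; elim/big_ind: _ => //; [exact: is_const1 | exact: is_constM]. Qed.

Lemma is_const_qpoch q x k : is_const q -> is_const x -> is_const (qpoch q x k).
Proof.
move=> cq cx; apply: is_const_prod => i.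
by apply: is_constB is_const1 _; apply: is_constM (is_constX _ _).
Qed.

(* Phi s is the value at the permuted variables X_(s 1), ..., X_(s n) of a
   polynomial that does not depend on s. *)
Definition poly_family (Phi : 'S_n -> frac) :=
  exists p : {mpoly K[n]}, forall s, Phi s = mpoly_frac (msym s p).

Lemma eq_poly_family Phi1 Phi2 : Phi1 =1 Phi2 -> poly_family Phi2 -> poly_family Phi1.
Proof. by move=> e [p pE]; exists p => s; rewrite e. Qed.

Lemma poly_family_const z : is_const z -> poly_family (fun=> z).
Proof.
by move=> [c ->]; exists c%:MP => s; rewrite /msym mmapC.
Qed.

Lemma poly_family_var r : poly_family (fun s => mpoly_frac 'X_(s r)).
Proof. by exists 'X_r => s; rewrite /msym mmapX mmap1U. Qed.

Lemma poly_familyD Phi1 Phi2 : poly_family Phi1 -> poly_family Phi2 ->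
  poly_family (fun s => Phi1 s + Phi2 s).
Proof.
move=> [p1 e1] [p2 e2]; exists (p1 + p2) => s.
by rewrite e1 e2 msymD /mpoly_frac rmorphD.
Qed.

Lemma poly_familyM Phi1 Phi2 : poly_family Phi1 -> poly_family Phi2 ->
  poly_family (fun s => Phi1 s * Phi2 s).
Proof.
move=> [p1 e1] [p2 e2]; exists (p1 * p2) => s.
by rewrite e1 e2 msymM /mpoly_frac rmorphM.
Qed.

Lemma poly_family_sum I (r : seq I) (P : pred I) (Phi : I -> 'S_n -> frac) :
  (forall i, poly_family (Phi i)) -> poly_family (fun s => \sum_(i <- r | P i) Phi i s).
Proof.
move=> h; elim: r => [|i r IH].
  apply: (@eq_poly_family _ (fun=> 0)) => [s|]; first by rewrite big_nil.
  by exists 0 => s; rewrite msym0 /mpoly_frac rmorph0.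
have [Pi|nPi] := boolP (P i).
  apply: (@eq_poly_family _ (fun s => Phi i s + \sum_(i <- r | P i) Phi i s)).
    by move=> s; rewrite big_cons Pi.
  exact: poly_familyD.
by apply: eq_poly_family IH => s; rewrite big_cons (negbTE nPi).
Qed.

Lemma poly_family_prod I (r : seq I) (Phi : I -> 'S_n -> frac) :
  (forall i, poly_family (Phi i)) -> poly_family (fun s => \prod_(i <- r) Phi i s).
Proof.
move=> h; elim: r => [|i r IH].
  apply: (@eq_poly_family _ (fun=> 1)) => [s|]; first by rewrite big_nil.
  exact/poly_family_const/is_const1.
apply: (@eq_poly_family _ (fun s => Phi i s * \prod_(i <- r) Phi i s)).
  by move=> s; rewrite big_cons.
exact: poly_familyM.
Qed.

Lemma poly_family_qpoch q (a : frac) r k : is_const q -> is_const a ->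
  poly_family (fun s => qpoch q (mpoly_frac 'X_(s r) * a) k).
Proof.
move=> cq ca; apply: poly_family_prod => i.
apply: (@eq_poly_family _ (fun s => 1 + mpoly_frac 'X_(s r) * (0 - a * q ^+ i))).
  by move=> s; rewrite sub0r mulrN mulrA.
apply: poly_familyD; first exact/poly_family_const/is_const1.
apply: poly_familyM (poly_family_var r) _; apply: poly_family_const.
apply: is_constB; last exact/is_constM/is_constX.
by exists 0; rewrite const_fracE rmorph0.
Qed.

Lemma mpoly_fracX_neq0 i : mpoly_frac 'X_i != 0 :> frac.
Proof.
by rewrite /mpoly_frac tofrac_eq0 -msize_poly_eq0 msizeX.
Qed.

(* The factors x of x^l cancel the denominators of (a / x; q)_l. *)
Lemma poly_family_qpochV q (a b : frac) r l : is_const q -> is_const a -> is_const b ->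
  poly_family (fun s =>
    (mpoly_frac 'X_(s r) * b) ^+ l * qpoch q (a / mpoly_frac 'X_(s r)) l).
Proof.
move=> cq ca cb.
apply: (@eq_poly_family _ (fun s =>
  \prod_(i < l) ((mpoly_frac 'X_(s r) + (0 - a * q ^+ i)) * b))).
  by move=> s; apply: expr_mul_qpochV; exact: mpoly_fracX_neq0.
apply: poly_family_prod => i; apply: poly_familyM; last exact: poly_family_const.
apply: poly_familyD; first exact: poly_family_var.
apply: poly_family_const; apply: is_constB; last exact/is_constM/is_constX.
by exists 0; rewrite const_fracE rmorph0.
Qed.

Lemma poly_family_vertexW q e s2 r i j k l : is_const q -> is_const e -> is_const s2 ->
  e != 0 -> poly_family (fun s => vertexW q (e / mpoly_frac 'X_(s r)) s2 i j k l).
Proof.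
move=> cq ce cs2 e0.
have [/andP[/eqP ijkl le_li]|bad] := boolP ((i + j == k + l) && (l <= i))%N; last first.
  apply: (@eq_poly_family _ (fun=> 0)); first by move=> s; rewrite /vertexW (negbTE bad).
  by apply: poly_family_const; exists 0; rewrite const_fracE rmorph0.
have cqq m : is_const (qpoch q q m) by apply: is_const_qpoch.
pose x (s : 'S_n) : frac := mpoly_frac 'X_(s r).
apply: (@eq_poly_family _ (fun s =>
  ((x s * (s2 / e)) ^+ l * qpoch q (e / x s) l) * qpoch q (x s * (s2 / e)) (i - l)
  * ((qpoch q s2 i)^-1 * (qpoch q q i / (qpoch q q (i - l) * qpoch q q l))))).
  move=> s; exact (vertexW_ratio q s2 (mpoly_fracX_neq0 (s r)) e0 ijkl le_li).
apply: poly_familyM; first apply: poly_familyM.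
- by apply: poly_family_qpochV => //; apply: is_constM (is_constV _).
- by apply: poly_family_qpoch => //; apply: is_constM (is_constV _).
apply: poly_family_const; apply: is_constM; first exact/is_constV/is_const_qpoch.
by apply: is_constM => //; apply/is_constV/is_constM.
Qed.

End PolynomialFamilies.

Section RationalFamilies.
Variables (K : fieldType) (n : nat) (q : K) (rxi rs : nat -> K).
Hypothesis gen : generic q rxi rs.

Let Q := const_frac n q.
Let RX i := const_frac n (rxi i).
Let RS i := const_frac n (rs i).
Let X (s : 'S_n) (r : 'I_n) : {fraction {mpoly K[n]}} := mpoly_frac 'X_(s r).

(** A constant has [msize] at most 1, a variable 2. This meets the inequations of [Fs_perm] at the
    indeterminates. *)
Lemma is_const_neq_var (z : {fraction {mpoly K[n]}}) (r : 'I_n) :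
  is_const z -> z != mpoly_frac 'X_r.
Proof.
move=> [c ->]; rewrite /const_frac /mpoly_frac tofrac_eq.
apply/eqP => /(congr1 (fun p : {mpoly K[n]} => msize p)); rewrite msizeC msizeX mdeg1.
by case: (c != 0).
Qed.

Lemma spar_shift_const k i : spar_shift RX RS k i = const_frac n (spar_shift rxi rs k i).
Proof. by rewrite /spar_shift /RX /RS !const_fracE !rmorphM fmorphV. Qed.

Lemma generic_const_frac : generic Q RX RS.
Proof.
case: gen => q0 q_nroot rxi0 rs0 g; split.
- by rewrite /Q const_fracE fmorph_eq0.
- by move=> k k0; rewrite /Q const_fracE -rmorphXn fmorph_eq1 q_nroot.
- by move=> i; rewrite /RX const_fracE fmorph_eq0.
- by move=> i; rewrite /RS const_fracE fmorph_eq0.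
move=> i k j; rewrite spar_shift_const /Q !const_fracE -!rmorphXn -rmorphM fmorph_eq1.
exact: g.
Qed.

Let constQ : is_const Q. Proof. exact: is_const_const. Qed.

Lemma is_const_xi i : is_const (xi RX i).
Proof. exact/is_constX/is_const_const. Qed.

Lemma is_const_spar i : is_const (spar RS i).
Proof. exact/is_constX/is_const_const. Qed.

Lemma is_const_spar_shift k i : is_const (spar_shift RX RS k i).
Proof. by rewrite spar_shift_const; apply: is_const_const. Qed.

Lemma is_const_cfac s la : (forall i, is_const (s i)) -> is_const (cfac Q s la).
Proof.
move=> cs; apply: is_const_prod => i; apply: is_constM.
  exact/is_const_qpoch/is_constX.
exact/is_constV/is_const_qpoch.
Qed.

Lemma is_const_negpow (s : nat -> {fraction {mpoly K[n]}}) la :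
  (forall i, is_const (s i)) -> is_const (negpow s la).
Proof.
move=> cs; apply: is_const_prod => i; apply: is_constX; rewrite -sub0r.
by apply: is_constB (cs _); exists 0; rewrite const_fracE rmorph0.
Qed.

(** Denominators in kappa occur only in the boundary and vertex symbols, each next to a power of
    kappa that clears it; the prefactor is constant. *)
Lemma poly_family_FF L la mu : poly_family (fun s => FF Q RX RS L la mu (X s)).
Proof.
have [Q0 Q_nroot RX0 RS0 _] := generic_const_frac.
have cM z1 z2 := @is_constM K n z1 z2; have cV z := @is_constV K n z.
apply: poly_familyM.
  apply/poly_family_const/is_constM; apply: is_constM.
  - by apply: is_const_negpow; exact: is_const_spar_shift.
  - by apply/is_constV/is_const_negpow; exact: is_const_spar.
  - by apply: is_const_cfac; exact: is_const_spar_shift.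
  by apply/is_constV/is_const_cfac; exact: is_const_spar.
apply: poly_family_sum => a; apply: poly_familyM.
  apply: poly_family_prod => r.
  apply: (@eq_poly_family _ _ _ (fun s =>
      ((X s r * (spar RS 0 / xi RX 0)) ^+ a r
        * qpoch Q (spar RS r.+1 * xi RX r.+1 / X s r) (a r)) * (qpoch Q Q (a r))^-1)).
    move=> s; rewrite -[RHS]mulrA; congr (_ ^+ _ * (qpoch _ _ _ / _)).
      by rewrite -[LHS]mulrA.
    by rewrite -[LHS]mulrA mulrC.
  apply: poly_familyM; last exact/poly_family_const/is_constV/is_const_qpoch.
  apply: poly_family_qpochV => //; first exact: cM (is_const_spar _) (is_const_xi _).
  exact: cM (is_const_spar _) (cV _ (is_const_xi _)).
apply: poly_family_sum => v; apply: poly_family_sum => h.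
apply: poly_family_prod => r; apply: poly_family_prod => c.
apply: (@poly_family_vertexW K n Q (xi RX (r.+1 + c.+1) * spar RS (r.+1 + c.+1))
  (spar_shift RX RS r.+1 c.+1 ^+ 2)).
- exact: constQ.
- exact: cM (is_const_xi _) (is_const_spar _).
- exact/is_constX/is_const_spar_shift.
exact: mulf_neq0 (expf_neq0 _ (RX0 _)) (expf_neq0 _ (RS0 _)).
Qed.

End RationalFamilies.

Theorem theorem5p9 (K : fieldType) (q : K) (rxi rs : nat -> K)
    (n L : nat) (la mu : seq nat) :
  generic q rxi rs ->
  (1 <= n)%N ->
  is_part la -> is_part mu ->
  (size la < L)%N -> (size mu < L)%N ->
  exists2 p : {mpoly K[n]},
    p \is symmetric & FF_rat n q rxi rs L la mu = mpoly_frac p.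
Proof.
move=> gen _ la_p mu_p la_L mu_L.
have [p pE] := poly_family_FF n gen L la mu.
(* [pE] gives the value at the permuted variables, and [Fs_perm] removes the permutation. *)
have FFp s : FF_rat n q rxi rs L la mu = mpoly_frac (msym s p).
  rewrite -pE; congr (_ * _); rewrite -(Fs_perm s (generic_const_frac n gen)) //.
    exact: mpoly_fracX_neq0.
  move=> r c i; apply: is_const_neq_var; apply: is_constM.
    by apply: is_constM; [exact: is_const_xi | exact: is_const_spar].
  exact/is_constX/is_const_const.
exists p; last by rewrite (FFp 1%g) msym1m.
(* [FFp] at s and at the identity describe the same fraction, and polynomials embed in their
   fractions. *)
apply/issymP => s; apply/eqP.
by rewrite -tofrac_eq -!/(mpoly_frac _) -FFp (FFp 1%g) msym1m.
Qed.
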